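(* Let $\theta$ be a skew diagram which does not contain two boxes in the same column, and let $\mu,\nu$ be partitions with $\ell(\nu)\le n$. Let $g_{\theta\mu}^{\nu}=g_{\theta\mu}^\nu(a,b)$ be defined by $$G_\theta(x|b)\,G_\mu(x|a)=\sum_{\nu:\ \ell(\nu)\le n}g_{\theta\mu}^{\nu}\,G_\nu(x|a).$$ Then $$g_{\theta\mu}^{\nu}=\sum_{(R,T)}\beta^{|T|-|\theta|}\,w(T),$$ where the sum is over all pairs $(R,T)$ in which $R$ is a sequence of partitions $$R:\ \mu=\rho^{(0)}\stackrel{r_1}{\longrightarrow}\rho^{(1)}\stackrel{r_2}{\longrightarrow}\cdots\stackrel{r_l}{\longrightarrow}\rho^{(l)}=\nu$$ and $T$ is a set-valued $\theta$-tableau (with barred entries) related to $R$.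
   Context: Fix a positive integer $n$, a field $\mathbb{F}$, an indeterminate $\beta$, variables $x=(x_1,\dots,x_n)$ and two sequences of variables $a=(a_i)_{i\in\mathbb{Z}}$, $b=(b_i)_{i\in\mathbb{Z}}$. Put $x\oplus y=x+y+\beta xy$, $\ominus x=\frac{-x}{1+\beta x}$. Partitions are identified with Young diagrams (box $(i,j)$ in row $i$ from the top, column $j$), $\ell(\lambda)$ is the number of nonzero parts, and partitions with at most $n$ parts are padded with zeros to length $n$; a skew diagram is $\lambda/\mu$ with $\mu\subset\lambda$; $|\cdot|$ counts boxes; $c(i,j)=j-i$. A set-valued $\theta$-tableau $T$ assigns to each box $\alpha\in\theta$ a non-empty $T(\alpha)\subset\{1,\dots,n\}$ such that $\max T(\alpha)\le\min T(\alpha')$ if $\alpha$ is immediately left of $\alpha'$, and $\max T(\alpha)<\min T(\alpha')$ if $\alpha$ is immediately above $\alpha'$. An entry of $T$ is a pair $(r,\alpha)$ with $r\in T(\alpha)$; $|T|$ is the number of entries. The factorial Grothendieck polynomial is $G_\theta(x|a)=\sum_T\beta^{|T|-|\theta|}\prod_{\alpha\in\theta,\,r\in T(\alpha)}(x_r\oplus a_{r+c(\alpha)})$. The $G_\lambda(x|a)$, $\ell(\lambda)\le n$, form a basis of the symmetric polynomials in $x_1,\dots,x_n$ over the field of rational functions in $\beta,a,b$, so $g_{\theta\mu}^\nu$ is well defined. For a partition $\lambda$ with at most $n$ parts, $(a_\lambda)_i=\ominus a_{n+1-i+\lambda_i}$, $1\le i\le n$. $\lambda\stackrel{r}{\longrightarrow}\mu$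 means $\mu$ is obtained from $\lambda$ by adding one box in row $r$. Order the entries of $T$ by $(r,(i,j))\prec(r',(i',j'))$ if $j>j'$, or $j=j'$ and $i<i'$, or $(i,j)=(i',j')$ and $r>r'$. $T$ is related to $R$ (with row labels $r_1,\dots,r_l$) if $T$ comes with distinguished (''barred'') entries $(r_1,\alpha_1)\prec(r_2,\alpha_2)\prec\dots\prec(r_l,\alpha_l)$ whose values are $r_1,\dots,r_l$ in this order; all other entries are unbarred. (A tableau with a different choice of barred entries counts as a different $T$.) The weight is $$w(T)=\prod_{(r,\alpha)\ \text{unbarred}}\Bigl((a_{\rho(r)})_r\oplus b_{r+c(\alpha)}\Bigr)\cdot\prod_{i=1}^{l}\bigl(1+\beta(a_{\rho^{(i-1)}})_{r_i}\bigr)\bigl(1+\beta b_{r_i+c(\alpha_i)}\bigr),$$ where for an unbarred entry $(r,\alpha)$, $\rho(r)=\rho^{(i)}$ if $(r_i,\alpha_i)\prec(r,\alpha)\prec(r_{i+1},\alpha_{i+1})$ (with $\rho(r)=\rho^{(0)}$ if it precedes all barred entries and $\rho(r)=\rho^{(l)}$ if it follows all of them). *)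

(* Defs.v *)
From HB Require Import structures.
From mathcomp Require Import all_boot all_order all_algebra.
From mathcomp Require Import finmap.
From mathcomp Require Import fraction.
From mathcomp Require Import mpoly.
From mathcomp Require monalg.

Set Implicit Arguments.
Unset Strict Implicit.
Unset Printing Implicit Defensive.

Import GRing.Theory.
Local Open Scope ring_scope.

(* Polynomials over a field in arbitrarily many variables form an integral
   domain: any two of them involve only a finite set D of variables, and
   [restr D] maps them to {mpoly F[#|D|]} without losing coefficients. *)
Module PolyIdomain.
Import monalg.
Local Notation "p @_ m" := (monalg.mcoeff m p) : ring_scope.
Local Notation "c %:MP" := (monalg.malgC c) : ring_scope.

Section Restrict.
Variables (F : fieldType) (V : choiceType) (D : {fset V}).
Let n := size D.
Let var_of (i : 'I_n) : V := tnth (in_tuple D) i.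

Definition rmon (m : {cmonom V}) : multinom n :=
  Multinom [tuple m (var_of i) | i < n].

Lemma rmonE m i : rmon m i = m (var_of i).
Proof. exact: mnmE. Qed.

Lemma rmon1 : rmon mone = mnm0.
Proof. by apply/mnmP => i; rewrite rmonE cm1 mnm0E. Qed.

Lemma rmon_inj (m1 m2 : {cmonom V}) :
  (finsupp m1 `<=` D)%fset -> (finsupp m2 `<=` D)%fset -> rmon m1 = rmon m2 -> m1 = m2.
Proof.
move=> /fsubsetP s1 /fsubsetP s2 eqm; apply/eqP/cmP => v.
have [vD|vD] := boolP (v \in D).
  have vi : (index v D < n)%N by rewrite index_mem.
  have <- : var_of (Ordinal vi) = v.
    by rewrite /var_of (tnth_nth v) /= nth_index.
  by rewrite -!rmonE eqm.
have out (m : {cmonom V}) : {subset finsupp m <= D} -> m v = 0%N.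
  by move=> s; case: mdomP => // /s vD'; rewrite vD' in vD.
by rewrite !out.
Qed.

Definition rX (m : {cmonom V}) : mpoly.mpoly n F := mpolyX F (rmon m).

Lemma rX_mmorphism : mmorphism rX.
Proof.
split=> [m1 m2|]; last by rewrite /rX rmon1 mpolyX0.
rewrite /rX -mpolyXD; congr mpolyX.
by apply/mnmP => i; rewrite mnmDE !rmonE cmM.
Qed.
HB.instance Definition _ :=
  isMultiplicative.Build {cmonom V} (mpoly.mpoly n F) rX rX_mmorphism.

Definition restr : {malg F[{cmonom V}]} -> mpoly.mpoly n F :=
  mmap (@mpolyC n F) rX.

Lemma restrM : {morph restr : p q / p * q}.
Proof. exact: rmorphM. Qed.

Lemma restr1 : restr 1 = 1.
Proof. exact: rmorph1. Qed.

Definition inD (p : {malg F[{cmonom V}]}) :=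
  forall m : {cmonom V}, m \in msupp p -> (finsupp m `<=` D)%fset.

Lemma mcoeff_restr p (m : {cmonom V}) : inD p -> (finsupp m `<=` D)%fset ->
  mpoly.mcoeff (rmon m) (restr p) = p@_m.
Proof.
move=> pD mD; rewrite /restr mmapE raddf_sum /=.
rewrite (eq_big_seq (fun k => p@_k * (k == m)%:R)); last first.
  move=> k kp /=; rewrite mpoly.mcoeffCM mpoly.mcoeffX; congr (_ * _%:R).
  by congr nat_of_bool; apply/eqP/eqP => [/rmon_inj->//|->//]; apply: pD.
have [mp|mp] := boolP (m \in msupp p).
  rewrite (big_fsetD1 m) //= eqxx mulr1 big_seq big1 ?addr0 // => k.
  by rewrite in_fsetD1 => /andP[/negbTE-> _]; rewrite mulr0.
rewrite big_seq big1 => [|k kp]; first by rewrite mcoeff_outdom.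
by case: eqP => [km|_]; rewrite ?mulr0 // -km kp in mp *.
Qed.

Lemma restr_eq0 p : inD p -> restr p = 0 -> p = 0.
Proof.
move=> pD p0; apply/malgP => m; rewrite mcoeff0.
have [mp|mp] := boolP (m \in msupp p); last by rewrite mcoeff_outdom.
by rewrite -(mcoeff_restr pD (pD _ mp)) p0 mpoly.mcoeff0.
Qed.

End Restrict.

Section Idomain.
Variables (F : fieldType) (V : choiceType).
Local Notation P := {malg F[{cmonom V}]}.
Implicit Types p q : P.

Lemma common_domain p q : exists D : {fset V}, inD D p /\ inD D q.
Proof.
exists (\bigcup_(m <- enum_fset (msupp p `|` msupp q)) finsupp m)%fset.
by split=> m mp; apply/fsubsetP => v vm; apply/bigfcupP; exists m => //;
  rewrite andbT in_fsetU mp ?orbT.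
Qed.

Lemma idomain_axiom p q : p * q = 0 -> (p == 0) || (q == 0).
Proof.
have [D [pD qD]] := common_domain p q.
move/(congr1 (@restr F V D)); rewrite restrM [X in _ = X]raddf0 => /eqP.
rewrite mulf_eq0 => /orP[] /eqP /restr_eq0 ->; rewrite ?eqxx ?orbT //.
Qed.

Definition unit : pred P := fun p => (p == (p@_mone)%:MP) && (p@_mone != 0).
Definition inv p : P := if p \in unit then (p@_mone)^-1%:MP else p.

Lemma mulVp : {in unit, left_inverse 1 inv *%R}.
Proof.
move=> p pU; rewrite /inv pU; case/andP: pU => /eqP {3}-> p1.
by rewrite -rmorphM mulVf ?rmorph1.
Qed.

Lemma intro_unit p q : q * p = 1 -> p \in unit.
Proof.
move=> qp1; apply/andP; split; last first.
  apply/eqP => p1; have /eqP := congr1 (mcoeff mone) qp1.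
  by rewrite [in X in X -> _]rmorphM /= p1 mulr0 mcoeff1 eqxx eq_sym oner_eq0.
have [D [pD qD]] := common_domain p q.
have := congr1 (@restr F V D) qp1; rewrite restrM restr1.
move/mpoly_intro_unit/andP => [/eqP pC _].
apply/eqP/malgP => m; rewrite mcoeffC.
have [->|m1] := eqVneq m mone; first by rewrite mulr1n.
have [mp|mp] := boolP (m \in msupp p); last by rewrite mcoeff_outdom.
rewrite -(mcoeff_restr pD (pD _ mp)) pC mpoly.mcoeffC.
case: eqP => [m0|_]; last by rewrite mulr0.
case/eqP: m1; apply: (rmon_inj (pD _ mp)); first by rewrite mdom1 fsub0set.
by rewrite rmon1.
Qed.

Lemma inv_out : {in [predC unit], inv =1 id}.
Proof. by rewrite /inv => p /negbTE /= ->. Qed.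

End Idomain.

Section Instances.
Variables (F : fieldType) (V : choiceType).
HB.instance Definition _ :=
  GRing.ComNzRing_hasMulInverse.Build (malg {cmonom V} F)
    (@mulVp F V) (@intro_unit F V) (@inv_out F V).
HB.instance Definition _ :=
  GRing.ComUnitRing_isIntegral.Build (malg {cmonom V} F) (@idomain_axiom F V).
End Instances.
End PolyIdomain.

(* The indeterminates: beta and the two sequences a and b indexed by int. *)
Variant param := Beta | ParA of int | ParB of int.

Definition param_code (v : param) : unit + (int + int) :=
  match v with Beta => inl tt | ParA i => inr (inl i) | ParB i => inr (inr i) end.
Definition param_decode (c : unit + (int + int)) : param :=
  match c with inl _ => Beta | inr (inl i) => ParA i | inr (inr i) => ParB i end.
Fact param_codeK : cancel param_code param_decode. Proof. by case. Qed.
HB.instance Definition _ := Choice.copy param (can_type param_codeK).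

Section RationalFunctions.
Import monalg PolyIdomain.
Variable F : fieldType.

(* F(beta, a, b): the fraction field of the polynomial ring over F in the
   infinitely many commuting indeterminates above. *)
Definition ratfun : fieldType := {fraction {malg F[{cmonom param}]}}.

Definition param_ratfun (v : param) : ratfun :=
  FracField.tofrac (mkmalgU (ucm v) (1 : F) : {malg F[{cmonom param}]}).

Definition par_beta : ratfun := param_ratfun Beta.
Definition par_a (i : int) : ratfun := param_ratfun (ParA i).
Definition par_b (i : int) : ratfun := param_ratfun (ParB i).

End RationalFunctions.

Definition oplus (R : comNzRingType) (beta x y : R) : R := x + y + beta * x * y.
Definition ominus (K : fieldType) (beta x : K) : K := - x / (1 + beta * x).

(* Partitions are weakly decreasing sequences of positive parts, so that
   [size] is the number of nonzero parts and [nth 0] pads with zeros. *)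
Definition is_part (s : seq nat) : bool := sorted geq s && (0%N \notin s).

Record part := Part { parts :> seq nat; _ : is_part parts }.
HB.instance Definition _ := [isSub for parts].
HB.instance Definition _ := [Choice of part by <:].

Definition part0 : part := @Part [::] isT.

Definition included (mu lam : seq nat) : Prop :=
  forall i, (nth 0%N mu i <= nth 0%N lam i)%N.

Record skew_shape := Skew { outer : part; inner : part; _ : included inner outer }.

Fact included0 (lam : part) : included part0 lam.
Proof. by move=> i; rewrite nth_nil. Qed.
Definition straight (lam : part) : skew_shape := Skew (included0 lam).

(* Rows and columns are numbered from 0; this does not affect contents. *)
Definition cells (th : skew_shape) : seq (nat * nat) :=
  [seq (i, j) | i <- iota 0 (size (outer th)),
     j <- iota (nth 0%N (inner th) i)
               (nth 0%N (outer th) i - nth 0%N (inner th) i)].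

Definition box (th : skew_shape) : finType := seq_sub (cells th).

Section Boxes.
Variable th : skew_shape.

Definition row (al : box th) : nat := (val al).1.
Definition col (al : box th) : nat := (val al).2.
Definition content (al : box th) : int := (col al)%:Z - (row al)%:Z.

Definition no_two_in_column : Prop :=
  forall al al' : box th, col al = col al' -> al = al'.

End Boxes.

Section Tableaux.
Variables (n : nat) (th : skew_shape).

(* The element r : 'I_n stands for the value r + 1 of {1, ..., n}. *)
Definition tableau := {ffun box th -> {set 'I_n}}.
Definition entry := ('I_n * box th)%type.

Definition set_valued (T : tableau) : bool :=
  [&& [forall al, T al != set0],
      [forall al, forall al',
         (row al' == row al) && (col al' == (col al).+1) ==>
         [forall r in T al, forall r' in T al', (r <= r')%N]] &
      [forall al, forall al',
         (col al' == col al) && (row al' == (row al).+1) ==>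
         [forall r in T al, forall r' in T al', (r < r')%N]]].

Definition entries (T : tableau) : {set entry} := [set e | e.1 \in T e.2].

(* The index r + c(alpha), where r is the value of the entry. *)
Definition shift (e : entry) : int := (e.1).+1%:Z + content e.2.

Definition prec (e e' : entry) : bool :=
  [|| (col e'.2 < col e.2)%N,
      (col e.2 == col e'.2) && (row e.2 < row e'.2)%N |
      (e.2 == e'.2) && (e'.1 < e.1)%N].

End Tableaux.

Definition Groth (K : fieldType) (n : nat) (th : skew_shape) (beta : K)
    (a : int -> K) : {mpoly K[n]} :=
  \sum_(T : tableau n th | set_valued T)
    beta ^+ (#|entries T| - #|box th|) *:
    \prod_(e in entries T) oplus beta%:MP 'X_(e.1) (a (shift e))%:MP.

(* (a_lam)_i = ominus a_{n + 1 - i + lam_i} for the 1-based index i = r + 1. *)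
Definition a_part (K : fieldType) (n : nat) (beta : K) (a : int -> K)
    (lam : seq nat) (r : 'I_n) : K :=
  ominus beta (a (n - r + nth 0%N lam r)%N%:Z).

Section Chains.
Variable n : nat.

(* A sequence R is encoded by its starting partition mu and its row labels;
   rho mu R i is its i-th term.  Adding a box to a row more than one step
   below the diagram makes [incr_nth] create zero parts, which is_chain
   rejects through [is_part].  If nu has at most n parts, all row labels are
   at most n, and a chain ending at nu has at most |nu| steps, so R may be
   taken in {bseq (sumn nu) of 'I_n}. *)
Definition rho (mu : seq nat) (R : seq 'I_n) (i : nat) : seq nat :=
  foldl incr_nth mu [seq val r | r <- take i R].

Definition is_chain (mu nu : part) (R : seq 'I_n) : bool :=
  all (fun i => is_part (rho mu R i)) (iota 0 (size R).+1)
  && (rho mu R (size R) == nu).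

End Chains.

Section Weight.
Variables (n : nat) (th : skew_shape).

(* A tableau with barred entries is a pair (T, B), B being the set of barred
   entries. *)
Definition barred_seq (B : {set entry n th}) : seq (entry n th) :=
  sort (fun e e' => (e == e') || prec e e') (enum B).

Definition related (R : seq 'I_n) (TB : tableau n th * {set entry n th}) : bool :=
  [&& set_valued TB.1, TB.2 \subset entries TB.1 &
      [seq e.1 | e <- barred_seq TB.2] == R].

(* rho_at e is rho^(i), i being the number of barred entries preceding e; for
   the i-th barred entry itself this is rho^(i-1). *)
Definition rho_at (mu : seq nat) (R : seq 'I_n) (B : {set entry n th})
    (e : entry n th) : seq nat :=
  rho mu R #|[set e' in B | prec e' e]|.

Definition weight (K : fieldType) (beta : K) (a b : int -> K) (mu : seq nat)
    (R : seq 'I_n) (TB : tableau n th * {set entry n th}) : K :=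
  (\prod_(e in entries TB.1 :\: TB.2)
     oplus beta (a_part beta a (rho_at mu R TB.2 e) e.1) (b (shift e)))
  * \prod_(e in TB.2)
     ((1 + beta * a_part beta a (rho_at mu R TB.2 e) e.1)
      * (1 + beta * b (shift e))).

End Weight.

(* Main.v *)
(* Write x ⊕ y for oplus and let the operator X_r act on formal combinations of
   partitions by rho |-> a' rho + (1 + beta a') (rho + box in row r), where
   a' = (a_rho)_r and the second term is dropped if it is not a partition.  An
   entry (r, alpha) of a tableau, barred or not, contributes X_r ⊕ b_{r+c(alpha)},
   so the right-hand side is G_theta(X_1, .., X_n | b) applied to mu, the
   noncommuting factors being taken in the order of the entries.

   Up to the Vandermonde factor, G_lambda(x|a) is the bialternant
   det[(x_i|a)^{lambda_j+n-j} (1 + beta x_i)^{j-1}]: both sides obey the same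
   branching rule on the largest value.  Multiplying the j-th column by its
   variable is X_j without the truncation to partitions.  The terms truncated by
   X_r add up to zero, because the rest of the sum over tableaux, multiplied by
   1 + beta x_r, is symmetric in x_{r-1} and x_r.  Hence the right-hand side
   expands G_theta(x|b) G_mu(x|a), and linear independence of the bialternants,
   seen by evaluating them at x = a_mu, identifies the coefficients. *)
Require Import Defs.
From mathcomp Require Import all_boot all_order all_algebra.
From mathcomp Require Import fingroup perm ring zify finmap fraction mpoly.
From mathcomp Require monalg.
Import Defs.
Import GRing.Theory.
Local Open Scope ring_scope.

Set Implicit Arguments.
Unset Strict Implicit.
Unset Printing Implicit Defensive.

(** * Symmetry of one-row sums *)

(** Without two boxes in a column, the order of the entries walks through the boxes from right to
    left, and a box is constrained only by its right neighbour. A sum over tableaux is therefore a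
    recursion that remembers just the smallest value of the previous box. Run with two different
    operators [op], this one recursion gives both G_theta(x|b) and the right-hand side. The obstacle
    is that a truncated term does not vanish by itself: its two rows have equal factorial exponents,
    but the powers of 1 + beta x still differ by one factor. Cancellation thus has to come from the
    partial sums that follow, whose values are bounded by some r and which are not symmetric. The
    relation [exchange] measures their failure to be symmetric and is stable under adding a box. All
    arguments run over any field in which every 1 + beta a_k is nonzero and a is injective; the
    generic parameters enter only at the end. The Vandermonde factor is never divided out: the
    defining relation of the coefficients is multiplied by it. *)

Section Transfer.
Variables (S : Type) (A : comNzRingType) (beta : A) (n : nat).
Variable op : nat -> int -> (S -> A) -> S -> A.

(* [op r c psi] places the value [r] in a box of content [c] and goes on with
   [psi].  [box_sum c r phi] sums over the nonempty sets of values below [r] in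
   this box, the largest value being placed first; [phi] receives the smallest.
   In [strip_sum], a box [(c, lk)] comes with its content and a flag telling
   whether it lies immediately to the left of the previous one, in which case
   its values are at most the smallest one there. *)
Fixpoint box_sum (c : int) (r : nat) (phi : nat -> S -> A) (s : S) : A :=
  if r is r'.+1 then
    box_sum c r' phi s
    + op r' c (fun s' => phi r' s' + beta * box_sum c r' phi s') s
  else 0.

Fixpoint strip_sum (D : S -> A) (bs : seq (int * bool)) (r : nat) : S -> A :=
  if bs is (c, lk) :: bs' then
    box_sum c (if lk then r else n) (fun m => strip_sum D bs' m.+1)
  else D.
End Transfer.

(** The drop of the content by one across a link is what makes the parameter b in [exchange] agree
    with that of the neighbouring box. *)
Fixpoint linked_strip (bs : seq (int * bool)) : bool :=
  if bs is (c, _) :: bs' then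
    (if bs' is (c', true) :: _ then c' == c - 1 else true) && linked_strip bs'
  else true.

Section Symmetry.
Variables (A : idomainType) (beta : A) (b : int -> A) (y : nat -> A) (n : nat).
Variable s : nat -> {rmorphism A -> A}.
Hypothesis s_beta : forall i, s i beta = beta.
Hypothesis s_b : forall i k, s i (b k) = b k.
Hypothesis sK : forall i, involutive (s i).
Hypothesis s_y : forall i, (i.+1 < n)%N -> s i (y i) = y i.+1.
Hypothesis s_yS : forall i, (i.+1 < n)%N -> s i (y i.+1) = y i.
Hypothesis s_y_neq : forall i j, (i.+1 < n)%N -> j != i -> j != i.+1 -> s i (y j) = y j.
Hypothesis y_inj : forall i, (i.+1 < n)%N -> y i != y i.+1.

(** With the trivial state [unit], the recursion is commutative and computes the Grothendieck
    polynomial of the strip. *)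
Definition mul_op (r : nat) (c : int) (psi : unit -> A) (t : unit) : A :=
  oplus beta (y r) (b (r.+1%:Z + c)) * psi t.

Local Notation W c r phi := (box_sum beta mul_op c r phi tt).
Local Notation V D bs r := (strip_sum beta n mul_op D bs r tt).

Lemma s_oplus i x k : s i (oplus beta x (b k)) = oplus beta (s i x) (b k).
Proof. by rewrite /oplus !rmorphD !rmorphM s_beta s_b. Qed.

(** Only [s r.-1] mixes a variable below the bound r with one that is not below it, so this is
    symmetry on each side of the bound. *)
Definition invariant_off (f : nat -> A) :=
  forall r i, (r <= n)%N -> (i.+1 < n)%N -> i.+1 != r -> s i (f r) = f r.

(* Here [f r] is a sum over fillings with values below [r], [c] the content of
   the first box.  This relation is the invariant that makes the induction on
   the boxes go through: it expresses [f r.+2] by a divided difference. *)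
Definition exchange (c : int) (f : nat -> A) :=
  forall r, (r.+1 < n)%N ->
  (y r - y r.+1) * (f r.+2 - f r.+1)
  = oplus beta (y r.+1) (b (r.+2%:Z + c)) * (1 + beta * y r)
    * (f r.+1 - s r (f r.+1)).

Section Box.
Variables (c : int) (phi : nat -> unit -> A).
(** [phi r] continues after a box with smallest value r; [f] re-indexes it by the exclusive bound.
    [exchange] never reads [f 0]. *)
Let f r := if r is r'.+1 then phi r' tt else 0.
Hypothesis phi_inv : forall r i, (r < n)%N -> (i.+1 < n)%N -> i != r ->
  s i (phi r tt) = phi r tt.
Hypothesis phi_exch : exchange (c - 1) f.

Let P r := phi r tt + beta * W c r phi.

Let W_inv_low r i : (r <= n)%N -> (i.+1 < n)%N -> (r <= i)%N ->
  s i (W c r phi) = W c r phi.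
Proof.
elim: r => [|r IHr] /= r_n i_n le_ri; first by rewrite rmorph0.
rewrite /mul_op rmorphD rmorphM s_oplus rmorphD rmorphM s_beta.
rewrite IHr ?(ltnW r_n) ?(ltnW le_ri) // phi_inv ?gtn_eqF ?neq_ltn ?le_ri ?orbT //.
by rewrite s_y_neq // neq_ltn ?ltnS ?(ltnW le_ri) ?le_ri.
Qed.

(** The tail behind the value r.+1 is 1 + beta y_r times a divided difference. The hypothesis on
    [phi] supplies phi r.+1 - phi r, and its parameter b is exactly that of the value r in the
    present box, because the content there is c - 1. *)
Lemma box_exchange_core r : (r.+1 < n)%N ->
  (y r - y r.+1) * P r.+1 = (1 + beta * y r) * (W c r.+1 phi - s r (W c r.+1 phi)).
Proof.
move=> r_n; have r_n' : (r < n)%N := ltnW r_n.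
have e := phi_exch r_n; rewrite /= in e.
rewrite (_ : r.+2%:Z + (c - 1) = r.+1%:Z + c) in e; last by rewrite !intS; ring.
rewrite /P /= /mul_op rmorphD rmorphM s_oplus rmorphD rmorphM s_beta s_y //.
rewrite (W_inv_low (ltnW r_n') r_n (leqnn r)).
set w := W c r phi in e *; set u := phi r tt in e *; set v := phi r.+1 tt in e *.
set su := s r u in e *; set bb := b _ in e *.
rewrite /oplus in e *.
have -> : v = u + (v - u) by ring.
set m := beta * _; have -> : (y r - y r.+1) * (u + (v - u) + m)
  = (y r - y r.+1) * (v - u) + (y r - y r.+1) * (u + m) by ring.
rewrite e /m; ring.
Qed.


Let box_exchange_sym r : (r.+1 < n)%N ->
  (y r - y r.+1) * s r (P r.+1)
  = (1 + beta * y r.+1) * (W c r.+1 phi - s r (W c r.+1 phi)).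
Proof.
move=> r_n; have /(congr1 (s r)) := box_exchange_core r_n.
move: (P _) (W c _ _) => p w.
rewrite !(rmorphM, rmorphB, rmorphD) !rmorph1 /= sK s_beta s_y // s_yS // => e.
by rewrite -opprB mulNr e; ring.
Qed.

(** Times y_r - y_(r+1), both sides become (1 + beta y_r)(1 + beta y_(r+1)) (W - s_r W). This
    symmetry is what later kills the truncated terms. *)
Lemma box_tail_sym r : (r.+1 < n)%N ->
  s r ((1 + beta * y r.+1) * P r.+1) = (1 + beta * y r.+1) * P r.+1.
Proof.
move=> r_n; have e := box_exchange_core r_n; have e' := box_exchange_sym r_n.
have nz : y r - y r.+1 != 0 by rewrite subr_eq0 y_inj.
apply: (mulfI nz); rewrite [RHS]mulrCA e rmorphM rmorphD rmorphM rmorph1.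
by rewrite s_beta s_yS // mulrCA e'; ring.
Qed.

Lemma box_invariant : invariant_off (fun r => W c r phi).
Proof.
elim=> [|r IHr] i r_n i_n neq; first by rewrite /= rmorph0.
rewrite eqSS in neq.
have [eir|neq'] := eqVneq i.+1 r; last first.
  rewrite /= /mul_op rmorphD rmorphM s_oplus rmorphD rmorphM s_beta.
  rewrite IHr ?(ltnW r_n) // phi_inv // s_y_neq //; first by rewrite eq_sym.
  by rewrite eq_sym.
(* The remaining case has bound i.+2, so both exchanged variables occur. It rests on (y_i ⊕ z)(1 +
   beta y_(i+1)) - (y_(i+1) ⊕ z)(1 + beta y_i) = y_i - y_(i+1). *)
rewrite -{r IHr neq r_n}eir.
have e := box_exchange_core i_n; have e' := box_exchange_sym i_n.
have nz : y i - y i.+1 != 0 by rewrite subr_eq0 y_inj.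
have -> : W c i.+2 phi
  = W c i.+1 phi + oplus beta (y i.+1) (b (i.+2%:Z + c)) * P i.+1 by [].
move: (P _) (W c i.+1 phi) e e' => p w e e'.
rewrite rmorphD rmorphM s_oplus s_yS //; apply: (mulfI nz).
move: (b _) => z.
by rewrite !mulrDr !(mulrCA (y i - y i.+1) (oplus _ _ _)) e e' /oplus; ring.
Qed.

Lemma box_exchange : exchange c (fun r => W c r phi).
Proof.
move=> r r_n.
have -> : W c r.+2 phi
  = W c r.+1 phi + oplus beta (y r.+1) (b (r.+2%:Z + c)) * P r.+1 by [].
by rewrite addrAC subrr add0r mulrCA box_exchange_core // mulrA.
Qed.
End Box.

(** The two properties are needed together: each box uses both for the boxes that follow it. An
    unlinked first box ignores the bound, so its sum is fully symmetric and both sides of [exchange]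
    vanish for every c. *)
Lemma strip_invariant_exchange D bs :
    (forall i, (i.+1 < n)%N -> s i (D tt) = D tt) -> linked_strip bs ->
  invariant_off (fun r => V D bs r) /\
  forall c, (if bs is (c', true) :: _ then c' == c else true) ->
    exchange c (fun r => V D bs r).
Proof.
move=> D_inv; elim: bs => [|[c lk] bs IHbs] /=.
  move=> _; split=> [r i _ i_n _|c _ r r_n] /=; first exact: D_inv.
  by rewrite D_inv // !subrr !mulr0.
case/andP=> c_bs /IHbs[V_inv V_exch].
have {}V_exch : exchange (c - 1) (fun r => V D bs r).
  by apply: V_exch; case: bs c_bs {IHbs V_inv} => [|[c' []]].
pose phi m := strip_sum beta n mul_op D bs m.+1.
have phi_inv r i : (r < n)%N -> (i.+1 < n)%N -> i != r -> s i (phi r tt) = phi r tt.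
  by move=> r_n i_n ir; apply: V_inv; rewrite ?eqSS.
have W_inv := box_invariant phi_inv V_exch.
case: lk; split.
- exact: W_inv.
- by move=> c' /eqP<-; apply: box_exchange phi_inv V_exch.
- by move=> r i _ i_n _; apply: W_inv; rewrite ?(ltn_eqF i_n).
- by move=> c' _ r r_n; rewrite W_inv ?subrr ?mulr0 // ltn_eqF.
Qed.

Lemma strip_invariant D bs i :
    (forall i, (i.+1 < n)%N -> s i (D tt) = D tt) -> linked_strip bs ->
  (i.+1 < n)%N -> s i (V D bs n) = V D bs n.
Proof.
move=> D_inv bs_lk i_n; have [+ _] := strip_invariant_exchange D_inv bs_lk.
by apply=> //; rewrite ltn_eqF.
Qed.

Lemma strip_tail_sym D c lk bs r :
    (forall i, (i.+1 < n)%N -> s i (D tt) = D tt) -> linked_strip ((c, lk) :: bs) ->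
    (r.+1 < n)%N ->
  let J := V D bs r.+2 + beta * W c r.+1 (fun m => strip_sum beta n mul_op D bs m.+1) in
  s r ((1 + beta * y r.+1) * J) = (1 + beta * y r.+1) * J.
Proof.
move=> D_inv /= /andP[c_bs bs_lk] r_n.
have [V_inv V_exch] := strip_invariant_exchange D_inv bs_lk.
pose phi m := strip_sum beta n mul_op D bs m.+1.
apply: (@box_tail_sym c phi) => // [r' i r'_n i_n ir|].
  by apply: V_inv; rewrite ?eqSS.
by apply: V_exch; case: bs c_bs {bs_lk V_inv phi} => [|[c' []]].
Qed.
End Symmetry.

(** * Partitions, factorial powers and alternants *)

Section Partitions.
Implicit Types (s : seq nat) (r : nat).

Lemma is_partP s :
  reflect ((forall i, (nth 0 s i.+1 <= nth 0 s i)%N)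
           /\ forall i, (i < size s)%N -> (0 < nth 0 s i)%N)
          (is_part s).
Proof.
apply: (iffP andP) => [[srt s0]|[dec pos]]; split.
- move=> i; have [lt|ge] := ltnP i.+1 (size s); last by rewrite nth_default.
  by move/(sortedP 0%N): srt; apply.
- by move=> i lt; rewrite lt0n; apply: contraNneq s0 => <-; apply: mem_nth.
- by apply/(sortedP 0%N) => i _; apply: dec.
- by apply/negP => /(nthP 0%N)[i lt e0]; have := pos i lt; rewrite e0.
Qed.

Lemma is_part_incr s r : is_part s ->
  is_part (incr_nth s r) = (r == 0%N) || (nth 0 s r < nth 0 s r.-1)%N.
Proof.
move=> /is_partP[dec pos]; apply/is_partP/idP.
  case: r => [|r] //= [/(_ r)]; rewrite !nth_incr_nth eqxx.
  by rewrite gtn_eqF // add0n add1n.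
move=> leg; have lt_r : (r <= size s)%N.
  case: r leg => // r /= lt; rewrite ltnNge; apply: contraL lt => ge.
  by rewrite [X in (_ < X)%N]nth_default.
split=> i.
  rewrite !nth_incr_nth; case: eqP => [er|_]; last first.
    by rewrite add0n (leq_trans (dec i)) ?leq_addl.
  by rewrite er in leg *; rewrite gtn_eqF.
rewrite size_incr_nth nth_incr_nth addn_gt0.
case: (ltnP r) => [lt /pos ->|ge]; first by rewrite orbT.
have er : r = size s by apply/eqP; rewrite eqn_leq lt_r.
by rewrite er ltnS leq_eqVlt => /orP[/eqP->|/pos->]; rewrite ?eqxx ?orbT.
Qed.

(** This includes the rows more than one step below the diagram, where both parts are 0. *)
Lemma is_part_incrN s r : is_part s -> ~~ is_part (incr_nth s r) ->
  exists2 r', r = r'.+1 & nth 0 s r'.+1 = nth 0 s r'.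
Proof.
move=> sp; rewrite is_part_incr //; case: r => //= r; rewrite -leqNgt => ge.
by exists r => //; apply/eqP; rewrite eqn_leq ge andbT; case/is_partP: sp.
Qed.

Lemma part_dec (s : part) i : (nth 0 s i.+1 <= nth 0 s i)%N.
Proof. by have /is_partP[dec _] := valP s. Qed.

Lemma part_nth_leq (s : part) i j : (i <= j)%N -> (nth 0 s j <= nth 0 s i)%N.
Proof.
elim: j => [|j IHj]; first by case: i.
rewrite leq_eqVlt => /orP[/eqP->//|/IHj]; exact/leq_trans/part_dec.
Qed.
End Partitions.

Section FactorialPower.
Variables (R : comNzRingType) (beta : R) (a : int -> R).

Definition facpow (x : R) (k : nat) : R := \prod_(t < k) oplus beta x (a t.+1%:Z).

Lemma facpowS x k : facpow x k.+1 = facpow x k * oplus beta x (a k.+1%:Z).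
Proof. by rewrite /facpow big_ord_recr. Qed.
End FactorialPower.

Section Alternant.
Variables (K : fieldType) (n : nat).
Local Notation A := {mpoly K[n]}.

Definition alternant (Q : A) : A := \sum_(sg : 'S_n) (-1) ^+ sg * msym sg Q.

Lemma alternantD : {morph alternant : P Q / P + Q}.
Proof.
move=> P Q; rewrite /alternant -big_split; apply: eq_bigr => sg _.
by rewrite msymD mulrDr.
Qed.

Lemma alternantM P Q : (forall sg, msym sg P = P) ->
  alternant (P * Q) = P * alternant Q.
Proof.
move=> symP; rewrite /alternant big_distrr; apply: eq_bigr => sg _ /=.
by rewrite msymM symP mulrCA.
Qed.

Lemma alternantC c Q : alternant (c%:MP * Q) = c%:MP * alternant Q.
Proof. by apply: alternantM => sg; rewrite -[c%:MP]mulr1 mul_mpolyC msymZ msym1. Qed.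

(* The terms are paired off instead of using [alternant Q = - alternant Q], which
   would be useless in characteristic 2. *)
Lemma alternant_eq0 (i j : 'I_n) Q : i != j -> msym (tperm i j) Q = Q ->
  alternant Q = 0.
Proof.
move=> ij symQ; rewrite /alternant (bigID (@odd_perm _)) /=.
rewrite [X in _ + X](reindex_inj (mulgI (tperm i j))) /=.
rewrite [X in _ + X](eq_big (fun sg : 'S_n => odd_perm sg)
  (fun sg => - ((-1) ^+ sg * msym sg Q))) => [|sg|sg _].
- by rewrite sumrN subrr.
- by rewrite odd_permM odd_tperm ij negbK.
- by rewrite odd_permM odd_tperm ij addTb signrN mulNr msymMm symQ.
Qed.

(** Out of range this is the identity, so that it is an involution for every i, as the hypothesis
    [sK] demands. *)
Definition adj (i : nat) : 'S_n :=
  if (insub i, insub i.+1) is (Some u, Some v) then tperm u v else 1%g.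

Lemma adjE i (u v : 'I_n) : u = i :> nat -> v = i.+1 :> nat -> adj i = tperm u v.
Proof. by move=> <- ev; rewrite /adj valK -ev valK. Qed.

Lemma adj_generate (P : A) :
  (forall i, (i.+1 < n)%N -> msym (adj i) P = P) -> forall sg, msym sg P = P.
Proof.
move=> adjP.
have lt_tperm d : forall i j : 'I_n, (i + d.+1 = j)%N -> msym (tperm i j) P = P.
  elim: d => [|d IHd] i j eij.
    rewrite -(@adjE i i j) //; last by rewrite -eij addn1.
    by apply: adjP; have := ltn_ord j; rewrite -eij addn1.
  have k_n : (i + d.+1 < n)%N by apply: leq_ltn_trans (ltn_ord j); rewrite -eij leq_add2l.
  pose k := Ordinal k_n.
  have ik : i != k by rewrite -val_eqE /= -[X in X == _]addn0 eqn_add2l.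
  have ij : i != j by rewrite -val_eqE /= -eij -[X in X == _]addn0 eqn_add2l.
  have kj : msym (tperm k j) P = P.
    rewrite -(@adjE k k j) ?adjP //=; last by rewrite -eij -addnS.
    by rewrite -addnS eij.
  (* Here k is j - 1, so (k j) is adjacent and (i k) spans a shorter distance. *)
  have -> : tperm i j = ((tperm i k) ^ (tperm k j))%g.
    by rewrite tpermJ tpermL tpermD // eq_sym.
  by rewrite /conjg tpermV !msymMm kj IHd.
have all_tperm i j : msym (tperm i j) P = P.
  have [lt|gt|e] := ltngtP i j.
  - by apply: (lt_tperm (j - i.+1)%N); rewrite addnS -addSn subnKC.
  - by rewrite tpermC; apply: (lt_tperm (i - j.+1)%N); rewrite addnS -addSn subnKC.
  - by rewrite (val_inj e) tperm1 msym1m.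
move=> sg; have [ts -> _] := prod_tpermP sg.
elim: ts => [|t ts IHts]; first by rewrite big_nil msym1m.
by rewrite big_cons msymMm all_tperm.
Qed.

Definition mvar (r : nat) : A := if insub r is Some i then 'X_i else 0.

Lemma mvarE (i : 'I_n) : mvar i = 'X_i.
Proof. by rewrite /mvar valK. Qed.

Lemma msymXi sg (i : 'I_n) : msym sg ('X_i : A) = 'X_(sg i).
Proof.
rewrite msymX; congr 'X_[_]; apply/mnmP => j; rewrite mnmE !mnm1E.
by rewrite -(inj_eq (@perm_inj _ sg)) permKV.
Qed.

Lemma msymC sg c : msym sg (c%:MP : A) = c%:MP.
Proof. by rewrite -[c%:MP]mulr1 mul_mpolyC msymZ msym1. Qed.

Lemma adj_mvar i : (i.+1 < n)%N -> msym (adj i) (mvar i) = mvar i.+1.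
Proof.
move=> i_n; rewrite (@adjE i (Ordinal (ltnW i_n)) (Ordinal i_n)) //.
by rewrite (mvarE (Ordinal (ltnW i_n))) (mvarE (Ordinal i_n)) msymXi tpermL.
Qed.

Lemma adj_mvarS i : (i.+1 < n)%N -> msym (adj i) (mvar i.+1) = mvar i.
Proof.
move=> i_n; rewrite (@adjE i (Ordinal (ltnW i_n)) (Ordinal i_n)) //.
by rewrite (mvarE (Ordinal (ltnW i_n))) (mvarE (Ordinal i_n)) msymXi tpermR.
Qed.

Lemma adj_mvarD i j : (i.+1 < n)%N -> j != i -> j != i.+1 ->
  msym (adj i) (mvar j) = mvar j.
Proof.
move=> i_n ji jSi; rewrite (@adjE i (Ordinal (ltnW i_n)) (Ordinal i_n)) //.
have [j_n|n_j] := ltnP j n; last by rewrite /mvar insubF ?msym0 // ltnNge n_j.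
by rewrite (mvarE (Ordinal j_n)) msymXi tpermD // -val_eqE eq_sym.
Qed.

Lemma adjK i : involutive (msym (adj i) : A -> A).
Proof.
move=> P; rewrite -msymMm /adj.
case: insub => [u|]; last by rewrite mulg1 msym1m.
by case: insub => [v|]; rewrite ?mulg1 ?tperm2 msym1m.
Qed.

Lemma mvar_inj i : (i.+1 < n)%N -> mvar i != mvar i.+1.
Proof.
move=> i_n; rewrite (mvarE (Ordinal (ltnW i_n))) (mvarE (Ordinal i_n)).
pose v (j : 'I_n) : K := (val j == i)%:R.
apply: contra_neq (oner_neq0 K) => /(congr1 (meval v)).
by rewrite !mevalXU /v /= eqxx gtn_eqF.
Qed.
End Alternant.

(** * Adding boxes to a factorial alternant *)

Section Pieri.
Variables (K : fieldType) (n : nat) (beta : K) (a b : int -> K).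
Hypothesis beta_a : forall k, 1 + beta * a k != 0.
Local Notation A := {mpoly K[n]}.
Local Notation betaA := (beta%:MP : A).
Local Notation aA := (fun k => (a k)%:MP : A).
Local Notation bA := (fun k => (b k)%:MP : A).
Local Notation X := (@mvar K n).

(** The diagonal product of the bialternant matrix: its alternant is the bialternant, and adding a
    box merely multiplies it by one linear factor. *)
Definition diag_term (rh : seq nat) : A :=
  \prod_(j < n) (facpow betaA aA 'X_j (nth 0%N rh j + (n - j.+1))
                 * (1 + betaA * 'X_j) ^+ j).

Definition row_param (rh : seq nat) (r : nat) : K :=
  ominus beta (a (n - r + nth 0%N rh r)%N%:Z).

(** The expansion X_r ⊕ b = (a' ⊕ b) + (1 + beta a')(1 + beta b) (adding a box). It acts on
    functions of partitions, so the factor placed first is the outermost one. *)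
Definition add_box_op (r : nat) (c : int) (psi : seq nat -> A) (rh : seq nat) : A :=
  (oplus beta (row_param rh r) (b (r.+1%:Z + c)))%:MP * psi rh
  + ((1 + beta * row_param rh r) * (1 + beta * b (r.+1%:Z + c)))%:MP
    * (if is_part (incr_nth rh r) then psi (incr_nth rh r) else 0).

Lemma diag_term_incr rh r : (r < n)%N ->
  diag_term (incr_nth rh r)
  = oplus betaA (X r) (a (n - r + nth 0%N rh r)%N%:Z)%:MP * diag_term rh.
Proof.
move=> r_n; rewrite /diag_term (bigD1 (Ordinal r_n)) //=.
rewrite [in RHS](bigD1 (Ordinal r_n)) //=.
rewrite nth_incr_nth eqxx add1n addSn facpowS (mvarE _ (Ordinal r_n)).
rewrite -addnS subnSK // [(n - r + _)%N]addnC.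
under eq_bigr => j jr.
  rewrite -val_eqE /= eq_sym in jr; rewrite nth_incr_nth (negbTE jr) add0n.
  over.
by rewrite [oplus _ _ _ * _]mulrA [oplus _ _ _ * (_ * _)]mulrA [oplus _ _ _ * _]mulrC.
Qed.

(** For q = ⊖p one has q ⊕ p = 0 and (1 + beta q)(1 + beta p) = 1, whence x ⊕ b = (q ⊕ b) + (1 +
    beta q)(1 + beta b)(x ⊕ p). The factor x ⊕ p is what the new box contributes. *)
Lemma mul_diag_term rh r k : (r < n)%N ->
  oplus betaA (X r) (b k)%:MP * diag_term rh
  = (oplus beta (row_param rh r) (b k))%:MP * diag_term rh
    + ((1 + beta * row_param rh r) * (1 + beta * b k))%:MP * diag_term (incr_nth rh r).
Proof.
move=> r_n; rewrite diag_term_incr // mulrA -mulrDl; congr (_ * _).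
rewrite /row_param; set p := a _; set x := X r.
have nz : 1 + beta * p != 0 := beta_a _.
have e1 : (1 + beta * ominus beta p) * (1 + beta * p) = 1.
  by rewrite /ominus; field.
have e2 : ominus beta p + p + beta * ominus beta p * p = 0.
  by rewrite /ominus; field.
move: (ominus beta p) e1 e2 => q e1 e2.
have /(congr1 (@mpolyC n K)) := e1; have /(congr1 (@mpolyC n K)) := e2.
rewrite /oplus !(mpolyCD, mpolyCM) mpolyC0 mpolyC1.
set P := p%:MP; set Q := q%:MP; set B := beta%:MP; set D := (b k)%:MP => e2' e1'.
have -> : Q + D + B * Q * D + (1 + B * Q) * (1 + B * D) * (x + P + B * x * P)
  = (1 + B * D) * (Q + P + B * Q * P) + D + (1 + B * D) * x * ((1 + B * Q) * (1 + B * P)) by ring.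
by rewrite e1' e2'; ring.
Qed.

(** After the illegal step, rows r and r.+1 carry the same factorial exponent, while 1 + beta x
    occurs to the powers r and r.+1. Removing the one surplus factor leaves something symmetric in
    the two variables. *)
Lemma diag_term_illegal rh r : (r.+1 < n)%N -> nth 0%N rh r.+1 = nth 0%N rh r ->
  exists2 Q, diag_term (incr_nth rh r.+1) = (1 + betaA * X r.+1) * Q
           & msym (adj n r) Q = Q.
Proof.
move=> r_n e; pose i := Ordinal (ltnW r_n); pose j := Ordinal r_n.
have ij : i != j by rewrite -val_eqE /= ltn_eqF.
rewrite /diag_term (bigD1 j) //= (bigD1 i) //= !nth_incr_nth eqxx gtn_eqF // add1n e add0n.
rewrite addSn -addnS subnSK //; move: (_ + _)%N => k.
pose u (l : 'I_n) : A := facpow betaA aA 'X_l k * (1 + betaA * 'X_l) ^+ r.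
set P := \prod_(_ | _) _.
exists (u i * u j * P); first by rewrite (mvarE _ j) exprS /u; ring.
have facX l : msym (tperm i j) (facpow betaA aA 'X_l k) = facpow betaA aA 'X_(tperm i j l) k.
  rewrite /facpow rmorph_prod; apply: eq_bigr => t _.
  by rewrite /oplus /= !(msymD, msymM) !msymC !msymXi.
have symX l m : msym (tperm i j) ((1 + betaA * 'X_l) ^+ m) = (1 + betaA * 'X_(tperm i j l)) ^+ m.
  by rewrite rmorphXn /= msymD msymM msymC msymXi msym1.
have symu l : msym (tperm i j) (u l) = u (tperm i j l) by rewrite /u msymM symX facX.
rewrite (@adjE n r i j) // 2!msymM !symu tpermL tpermR [u j * _]mulrC; congr (_ * _).
rewrite /P rmorph_prod; apply: eq_bigr => l /andP[lj li] /=.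
rewrite msymM symX; congr (_ * _); last by rewrite tpermD // eq_sym.
rewrite /facpow rmorph_prod; apply: eq_bigr => t _.
by rewrite /oplus /= !(msymD, msymM) !msymC !msymXi tpermD // eq_sym.
Qed.

Local Notation VY bs r := (strip_sum betaA n (mul_op betaA bA X) (fun=> 1) bs r tt).
Local Notation WY bs c r :=
  (box_sum betaA (mul_op betaA bA X) c r
     (fun m => strip_sum betaA n (mul_op betaA bA X) (fun=> 1) bs m.+1) tt).

Lemma strip_sum_alternant bs r rh : linked_strip bs -> (r <= n)%N -> is_part rh ->
  strip_sum betaA n add_box_op (fun rh => alternant (diag_term rh)) bs r rh
  = alternant (VY bs r * diag_term rh).
Proof.
elim: bs r rh => [|[c lk] bs IHbs] r rh; first by rewrite mul1r.
move=> bs_lk r_n rh_part.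
have bs_lk' : linked_strip bs by case/andP: bs_lk.
pose phiX m := strip_sum betaA n add_box_op (fun rh => alternant (diag_term rh)) bs m.+1.
suff box q : (q <= n)%N -> forall rh, is_part rh ->
    box_sum betaA add_box_op c q phiX rh = alternant (WY bs c q * diag_term rh).
  by rewrite /=; case: (lk); apply: box.
elim: q => [|q IHq] q_n {}rh {}rh_part.
  by rewrite /= mul0r /alternant big1 // => sg _; rewrite msym0 mulr0.
(* [J] is the sum over everything that can follow once q has been placed in the current box. *)
pose J : A := VY bs q.+1 + beta%:MP * WY bs c q.
have JX rh' : is_part rh' ->
    phiX q rh' + betaA * box_sum betaA add_box_op c q phiX rh' = alternant (J * diag_term rh').
  move=> rh'_part; rewrite /phiX IHbs // IHq ?(ltnW q_n) //.
  by rewrite -alternantC -alternantD mulrA -mulrDl.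
have -> : WY bs c q.+1 = WY bs c q + oplus betaA (X q) (b (q.+1%:Z + c))%:MP * J by [].
rewrite mulrDl alternantD -[_ * J * _]mulrA [oplus _ _ _ * _]mulrCA mul_diag_term //.
rewrite mulrDr alternantD !(mulrCA J) !alternantC.
transitivity (box_sum betaA add_box_op c q phiX rh + add_box_op q c
  (fun rh' => phiX q rh' + betaA * box_sum betaA add_box_op c q phiX rh') rh) => //.
rewrite IHq ?(ltnW q_n) // /add_box_op JX //; congr (_ + (_ + _ * _)).
(* On the truncated branch the alternant must vanish. The surplus factor 1 + beta x_q of the illegal
   diagonal term is exactly what makes [J] symmetric. *)
case: ifPn => [|illegal]; first exact: JX.
have [q' eq e] := is_part_incrN rh_part illegal; subst q.
have [Q -> symQ] := diag_term_illegal q_n e.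
have neq : Ordinal (ltnW q_n) != Ordinal q_n by rewrite -val_eqE /= ltn_eqF.
rewrite (alternant_eq0 neq) // -(@adjE n q') // mulrA [J * _]mulrC msymM symQ.
congr (_ * _).
apply: (@strip_tail_sym A betaA bA X n (fun i => msym (adj n i))
  _ _ _ _ _ _ _ (fun=> 1) c lk bs q') => //.
- by move=> i; apply: msymC.
- by move=> i k; apply: msymC.
- exact: adjK.
- exact: adj_mvar.
- exact: adj_mvarS.
- exact: adj_mvarD.
- exact: mvar_inj.
- by move=> i _; apply: msym1.
Qed.


(** The recursion leaves the strip polynomial inside the alternant; being symmetric, it can be taken
    out. *)
Lemma strip_sum_mul_alternant bs mu : linked_strip bs -> is_part mu ->
  VY bs n * alternant (diag_term mu)
  = strip_sum betaA n add_box_op (fun rh => alternant (diag_term rh)) bs n mu.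
Proof.
move=> bs_lk mu_part; rewrite strip_sum_alternant // alternantM //.
apply: adj_generate => i i_n.
apply: (@strip_invariant A betaA bA X n (fun i => msym (adj n i))) => //.
- by move=> j; apply: msymC.
- by move=> j k; apply: msymC.
- exact: adjK.
- exact: adj_mvar.
- exact: adj_mvarS.
- exact: adj_mvarD.
- exact: mvar_inj.
- by move=> j _; apply: msym1.
Qed.
End Pieri.

(** * Set-valued fillings of a sequence of boxes *)

Section SetSum.
Variable n : nat.
Implicit Type B : {set 'I_n}.

(** The default n exceeds every value, which makes [leq_min_entry] true for the empty set too. *)
Definition min_entry B : nat := head n [seq val v | v <- enum B].
Definition below (r : nat) : {set 'I_n} := [set v : 'I_n | (v < r)%N].

Lemma sorted_enum_set B : sorted ltn [seq val v | v <- enum B].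
Proof.
rewrite sorted_map {1}/enum_mem; apply: sorted_filter.
  by move=> u v w; apply: ltn_trans.
by rewrite -sorted_map -enumT val_enum_ord iota_ltn_sorted.
Qed.

Lemma leq_min_entry B (v : 'I_n) :
  (v <= min_entry B)%N = [forall v' in B, (v <= v')%N].
Proof.
have srt := sorted_enum_set B.
apply/idP/'forall_implyP => [le v' v'B|all_v].
  apply: leq_trans le _; rewrite /min_entry; move: srt.
  have: val v' \in [seq val v | v <- enum B] by rewrite map_f ?mem_enum.
  case: [seq _ | _ <- _] => //= x l; rewrite inE => /orP[/eqP-> //|v'l].
  by move/(order_path_min ltn_trans)/allP => /(_ _ v'l)/ltnW.
rewrite /min_entry; case e: (enum B) => [|x l] /=; first exact: ltnW.
by apply: all_v; rewrite -mem_enum e mem_head.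
Qed.

Lemma enum_setU_max B (v : 'I_n) : B \subset below v ->
  enum (v |: B) = rcons (enum B) v.
Proof.
move=> B_v; apply: (inj_map val_inj); apply: (irr_sorted_eq ltn_trans ltnn).
- exact: sorted_enum_set.
- rewrite map_rcons sorted_pairwise; last exact: ltn_trans.
  rewrite pairwise_rcons -sorted_pairwise ?sorted_enum_set; last exact: ltn_trans.
  rewrite andbT; apply/allP => _ /mapP[u + ->]; rewrite mem_enum.
  by move/(subsetP B_v); rewrite inE.
- move=> u; apply: eq_mem_map => {}u.
  by rewrite mem_rcons in_cons !mem_enum in_setU1.
Qed.

Lemma min_entry_setU_max B (v : 'I_n) : B \subset below v -> B != set0 ->
  min_entry (v |: B) = min_entry B.
Proof.
move=> B_v B0; rewrite /min_entry enum_setU_max // map_rcons.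
case e: (enum B) => [|//]; case/set0Pn: B0 => u.
by rewrite -mem_enum e.
Qed.

Lemma ltn_min_entry B : B != set0 -> (min_entry B < n)%N.
Proof.
move=> B0; rewrite /min_entry; case e: (enum B) => [|x l] //=.
by case/set0Pn: B0 => u; rewrite -mem_enum e.
Qed.

Lemma min_entry1 (v : 'I_n) : min_entry [set v] = v.
Proof. by rewrite /min_entry enum_set1. Qed.

Lemma cardsU_max B (v : 'I_n) : B \subset below v -> #|v |: B| = #|B|.+1.
Proof.
move=> B_v; rewrite cardsU1; case: (boolP (v \in B)) => // /(subsetP B_v).
by rewrite inE ltnn.
Qed.

Variables (S : Type) (A : comNzRingType) (beta : A).
Variable op : nat -> int -> (S -> A) -> S -> A.
Hypothesis op_ext : forall r c psi psi', psi =1 psi' -> op r c psi =1 op r c psi'.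
Hypothesis opD : forall r c psi psi' s,
  op r c (fun s => psi s + psi' s) s = op r c psi s + op r c psi' s.
Hypothesis opZ : forall r c k psi s, op r c (fun s => k * psi s) s = k * op r c psi s.

Lemma op_sum r c (I : finType) (P : pred I) (F : I -> S -> A) s :
  op r c (fun s => \sum_(i | P i) F i s) s = \sum_(i | P i) op r c (F i) s.
Proof.
elim: (index_enum I) => [|i e IHe].
  rewrite !big_nil -[RHS](mul0r (op r c (fun=> 0) s)) -opZ.
  by apply: op_ext => s'; rewrite big_nil mul0r.
rewrite big_cons -IHe; case: ifP => Pi.
  by rewrite -opD; apply: op_ext => s'; rewrite big_cons Pi.
by apply: op_ext => s'; rewrite big_cons Pi.
Qed.

Definition apply_entries (c : int) (l : seq 'I_n) (phi : S -> A) : S -> A :=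
  foldr (fun (v : 'I_n) psi => op v c psi) phi l.

(** The list is reversed because larger values are placed first. The induction splits the sets by
    whether they contain the largest admissible value. *)
Lemma box_sum_sets c r phi s : (r <= n)%N ->
  box_sum beta op c r phi s
  = \sum_(B : {set 'I_n} | (B != set0) && (B \subset below r))
      beta ^+ #|B|.-1 * apply_entries c (rev (enum B)) (phi (min_entry B)) s.
Proof.
elim: r s => [|r IHr] s r_n.
  rewrite big_pred0 // => B; apply/negbTE; rewrite negb_and negbK orbC -implybE.
  apply/implyP => B0; rewrite -subset0; apply: subset_trans B0 _.
  by apply/subsetP => v; rewrite inE.
pose v := Ordinal r_n; rewrite (bigID (fun B => v \in B)) /= addrC.
congr (_ + _).
  rewrite IHr ?(ltnW r_n) //; apply: eq_bigl => B; rewrite -andbA; congr (_ && _).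
  apply/subsetP/andP => [B_r|[/subsetP B_r vB] u uB].
    split; last by apply/negP => /B_r; rewrite inE ltnn.
    by apply/subsetP => u /B_r; rewrite !inE => /ltnW.
  have := B_r u uB; rewrite !inE ltnS leq_eqVlt => /orP[/eqP eu|//].
  by case/negP: vB; rewrite (_ : v = u) //; apply: val_inj.
rewrite (reindex_onto (fun B => v |: B) (fun B => B :\ v)) /=; last first.
  by move=> B /andP[_ vB]; rewrite setD1K.
transitivity (\sum_(B : {set 'I_n} | B \subset below r)
  beta ^+ #|B| * op r c (apply_entries c (rev (enum B)) (phi (min_entry (v |: B)))) s).
  (* If nothing lies below the largest value, the recursion takes its [phi] branch; otherwise it
     takes the other one, with one more beta. *)
  rewrite (bigD1 set0) ?sub0set //= cards0 mul1r enum_set0 setU0 min_entry1 opD.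
  congr (_ + _); rewrite opZ (op_ext _ _ (fun s' => IHr s' (ltnW r_n))) op_sum big_distrr /=.
  apply: eq_big => [B|B /andP[B0 B_r]]; first by rewrite andbC.
  by rewrite opZ mulrA -exprS prednK ?card_gt0 // min_entry_setU_max.
apply: eq_big => [B|B B_r]; last first.
  by rewrite cardsU_max // enum_setU_max // rev_rcons.
have vvB : v \in v |: B by rewrite setU11.
rewrite vvB (_ : v |: B != set0) ?andbT /=; last by apply/set0Pn; exists v.
rewrite subUset sub1set inE ltnS leqnn /=.
apply/idP/andP => [B_r|[B_r /eqP eB]].
  split; first by apply: subset_trans B_r _; apply/subsetP => u; rewrite !inE => /ltnW.
  by rewrite setU1K //; apply/negP => /(subsetP B_r); rewrite inE ltnn.
apply/subsetP => u uB; have := subsetP B_r u uB; rewrite !inE ltnS leq_eqVlt.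
case/orP=> // /eqP eu; move: uB; rewrite -eB (_ : u = v) ?in_setD1 ?eqxx //.
exact: val_inj.
Qed.

Lemma apply_entries_ext c l phi phi' : phi =1 phi' ->
  apply_entries c l phi =1 apply_entries c l phi'.
Proof. by move=> e; elim: l => //= v l IHl; apply: op_ext. Qed.

Lemma apply_entriesZ c l k phi s :
  apply_entries c l (fun s => k * phi s) s = k * apply_entries c l phi s.
Proof.
elim: l s => //= v l IHl s; rewrite -opZ.
exact: op_ext.
Qed.

Lemma apply_entries_sum c l (I : finType) (P : pred I) (F : I -> S -> A) s :
  apply_entries c l (fun s => \sum_(i | P i) F i s) s
  = \sum_(i | P i) apply_entries c l (F i) s.
Proof.
elim: l s => //= v l IHl s; rewrite -op_sum.
exact: op_ext.
Qed.

Section Fillings.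
Variables (I : finType) (ct : I -> int) (lk : I -> bool).
Local Notation filling := {ffun I -> {set 'I_n}}.
Implicit Types (T : filling) (bl : seq I).

Fixpoint strip_filling T bl (r : nat) : bool :=
  if bl is al :: bl' then
    [&& T al != set0, T al \subset below (if lk al then r else n)
      & strip_filling T bl' (min_entry (T al)).+1]
  else true.

Definition filling_entries T bl : seq ('I_n * I) :=
  flatten [seq [seq (v, al) | v <- rev (enum (T al))] | al <- bl].

(** Fillings are functions on all boxes; forcing them to be empty off the list makes each partial
    filling count once. *)
Definition supported bl T := [forall al, (al \notin bl) ==> (T al == set0)].

Definition update T al B : filling := [ffun x => if x == al then B else T x].

Lemma strip_filling_ext T T' bl r : {in bl, T =1 T'} ->
  strip_filling T bl r = strip_filling T' bl r.
Proof.
elim: bl r => //= al bl IHbl r e; rewrite e ?mem_head // IHbl // => x xbl.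
by rewrite e // inE xbl orbT.
Qed.

Lemma filling_entries_ext T T' bl : {in bl, T =1 T'} ->
  filling_entries T bl = filling_entries T' bl.
Proof. by move=> e; congr flatten; apply/eq_in_map => al /e->. Qed.

(** Through [update], a filling of [al :: bl] is a set for [al] together with a filling supported on
    [bl]. *)
Lemma strip_sum_fillings D bl r s : uniq bl -> (r <= n)%N ->
  strip_sum beta n op D [seq (ct al, lk al) | al <- bl] r s
  = \sum_(T | supported bl T && strip_filling T bl r)
      beta ^+ (\sum_(al <- bl) #|T al|.-1)
      * foldr (fun e psi => op (val e.1) (ct e.2) psi) D (filling_entries T bl) s.
Proof.
elim: bl r s => [|al bl IHbl] r s.
  move=> _ _; rewrite (big_pred1 [ffun=> set0]) => [|T].
    by rewrite big_nil mul1r.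
  rewrite andbT /=; apply/forallP/eqP => [T0|-> x]; last by rewrite ffunE eqxx.
  by apply/ffunP => x; rewrite ffunE; apply/eqP/(implyP (T0 x)).
move=> /andP[al_bl bl_uniq] r_n.
rewrite [strip_sum _ _ _ _ _ _]/= box_sum_sets; last by case: (lk al).
set q := if lk al then r else n.
pose term T := beta ^+ (\sum_(al <- bl) #|T al|.-1).
pose tailop T := foldr (fun e psi => op (val e.1) (ct e.2) psi) D (filling_entries T bl).
transitivity (\sum_(B : {set 'I_n} | (B != set0) && (B \subset below q))
  \sum_(T | supported bl T && strip_filling T bl (min_entry B).+1)
    beta ^+ #|B|.-1 * (term T * apply_entries (ct al) (rev (enum B)) (tailop T) s)).
  apply: eq_bigr => B /andP[B0 B_q]; rewrite -big_distrr; congr (_ * _) => /=.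
  under [RHS]eq_bigr => T _ do rewrite -apply_entriesZ.
  rewrite -apply_entries_sum; apply: apply_entries_ext => s' /=.
  by apply: IHbl => //; apply: ltn_min_entry.
rewrite (pair_big_dep (fun B : {set 'I_n} => (B != set0) && (B \subset below q))) /=.
rewrite [RHS](reindex_onto (fun BT : {set 'I_n} * filling => update BT.2 al BT.1)
  (fun T => (T al, update T al set0))) /=; last first.
  move=> T _; apply/ffunP => x; rewrite !ffunE.
  by case: eqP => [->|].
have upd_al T B : update T al B al = B by rewrite ffunE eqxx.
have upd_bl T B : {in bl, update T al B =1 T}.
  by move=> x xbl; rewrite ffunE; case: eqP => // ex; rewrite -ex xbl in al_bl.
apply: eq_big => [[B T]|[B T] _] /=; rewrite ?upd_al; last first.
  rewrite big_cons upd_al exprD -mulrA; congr (_ * _).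
  rewrite (eq_big_seq (fun x => #|T x|.-1)) => [|x xbl]; last by rewrite upd_bl.
  congr (_ * _); rewrite /filling_entries /= upd_al foldr_cat.
  rewrite -/(filling_entries _ _) (filling_entries_ext (upd_bl T B)).
  by rewrite /apply_entries -[X in _ = X s]/(_ s) foldr_map.
rewrite -/q (strip_filling_ext _ (upd_bl T B)) andbA [RHS]andbC !andbA.
have -> : ((B, update (update T al B) al set0) == (B, T)) = (T al == set0).
  rewrite xpair_eqE eqxx /=; apply/eqP/eqP => [<-|T0]; first by rewrite upd_al.
  by apply/ffunP => x; rewrite !ffunE; case: eqP => [->|].
have -> : supported bl T = (T al == set0) && supported (al :: bl) (update T al B).
  apply/forallP/andP => [T0|[Tal /forallP T0] x].
    split; first exact: (implyP (T0 al)).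
    apply/forallP => x; rewrite in_cons negb_or ffunE.
    by case: eqP => //= _; apply: T0.
  have := T0 x; rewrite in_cons negb_or ffunE; case: eqP => [->|] //=.
  by rewrite Tal implybT.
by case: (T al == set0); case: (supported _ _); rewrite ?andbF ?andbT // -!andbA.
Qed.
End Fillings.
End SetSum.

(** * Shapes without two boxes in a column *)

Section Shape.
Variables (n : nat) (theta : skew_shape).
Hypothesis theta_col : no_two_in_column theta.
Local Notation box := (box theta).
Implicit Types (al : box) (bl : seq box) (T : tableau n theta).

Definition boxes : seq box := sort (fun al al' => col al' <= col al)%N (enum box).
Definition right_of al al' : bool := (row al' == row al) && (col al' == (col al).+1).
Definition joined al : bool := [exists al', right_of al al'].
Definition strip : seq (int * bool) := [seq (content al, joined al) | al <- boxes].

Lemma mem_boxes al : al \in boxes.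
Proof. by rewrite mem_sort mem_enum. Qed.

Lemma boxes_uniq : uniq boxes.
Proof. by rewrite sort_uniq enum_uniq. Qed.

Lemma right_of_inj al al1 al2 : right_of al al1 -> right_of al al2 -> al1 = al2.
Proof. by move=> /andP[_ /eqP e1] /andP[_ /eqP e2]; apply: theta_col; rewrite e1 e2. Qed.

(** The property of final segments of [boxes] that survives in inductions: every box outside lies
    strictly to the right of those inside. *)
Definition leftmost bl : bool := pairwise (fun al al' => col al' < col al)%N bl &&
  all (fun al => [forall al', (al' \notin bl) ==> (col al < col al')%N]) bl.

Lemma boxes_leftmost : leftmost boxes.
Proof.
apply/andP; split; last by apply/allP => al _; apply/forallP => al'; rewrite mem_boxes.
have: pairwise [rel al al' | (col al' <= col al)%N] boxes.
  rewrite -sorted_pairwise; first by apply: sort_sorted => al al'; apply: leq_total.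
  by move=> x y z /= yx zx; apply: leq_trans yx.
move: boxes_uniq; rewrite uniq_pairwise => u p.
have: pairwise [rel al al' | (al != al') && (col al' <= col al)%N] boxes.
  by rewrite pairwise_relI u.
apply: sub_pairwise => al al' /= /andP[neq]; rewrite leq_eqVlt => /orP[/eqP e|//].
by rewrite (theta_col e) eqxx in neq.
Qed.

Lemma leftmost_cons al bl : leftmost (al :: bl) -> leftmost bl.
Proof.
move=> /andP[/= /andP[/allP al_bl p] /andP[_ /allP all_bl]]; apply/andP; split=> //.
apply/allP => al1 al1_bl; apply/forallP => al'; apply/implyP => al'_bl.
have := forallP (all_bl _ al1_bl) al'; rewrite in_cons negb_or al'_bl andbT.
by case: eqP => [->|]; rewrite ?al_bl.
Qed.

Lemma leftmost_right_notin al bl al' : leftmost (al :: bl) -> right_of al al' ->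
  al' \notin al :: bl.
Proof.
move=> /andP[/= /andP[/allP al_bl _] _] /andP[_ /eqP e].
apply/negP; rewrite in_cons => /orP[/eqP ea|/al_bl]; first by rewrite ea in e; lia.
by rewrite e; lia.
Qed.

Lemma leftmost_right al bl al1 al' : leftmost (al :: bl) -> al1 \in bl ->
  right_of al1 al' -> al' \notin bl -> al' = al.
Proof.
move=> /andP[/= /andP[/allP al_bl _] /andP[/forallP out _]] al1_bl /andP[_ /eqP e] al'_bl.
have := out al'; rewrite in_cons negb_or al'_bl andbT; case: eqP => //= _.
by have := al_bl _ al1_bl; rewrite e; lia.
Qed.

(** Columns strictly decrease along the list, so a right neighbour, being one column away, can only
    be the box listed just before. *)
Lemma linked_strip_boxes : linked_strip strip.
Proof.
rewrite /strip; elim: boxes boxes_leftmost => //= al bl IHbl lm.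
rewrite IHbl ?andbT; last exact: leftmost_cons lm.
case: bl lm {IHbl} => //= al1 bl lm.
case: (boolP (joined al1)) => // /existsP[al' al1_al'].
have e := leftmost_right lm (mem_head _ _) al1_al'
  (leftmost_right_notin (leftmost_cons lm) al1_al').
move: al1_al'; rewrite e => /andP[/eqP er /eqP ec].
by rewrite /content er ec; apply/eqP; lia.
Qed.

(** A right neighbour outside [bl] has been filled before; the hypothesis on r says that the bound
    passes on its smallest value. *)
Lemma strip_filling_boxes T bl r : leftmost bl ->
  (forall al al', al \in bl -> al' \notin bl -> right_of al al' ->
     r = (min_entry (T al')).+1) ->
  strip_filling joined T bl r
  = all (fun al => (T al != set0) && [forall al', right_of al al' ==>
       [forall v in T al, forall v' in T al', (v <= v')%N]]) bl.
Proof.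
elim: bl r => //= al bl IHbl r lm r_right.
rewrite IHbl; last 2 first.
- exact: leftmost_cons lm.
- by move=> al1 al' al1_bl al'_bl rgt; rewrite (leftmost_right lm al1_bl rgt al'_bl).
rewrite andbA; congr (_ && _ && _).
case: (boolP (joined al)) => [/existsP[al' al_al']|no_right]; last first.
  rewrite (_ : T al \subset _); last by apply/subsetP => v; rewrite inE.
  symmetry; apply/forallP => al'; apply/implyP => al_al'.
  by case/negP: no_right; apply/existsP; exists al'.
rewrite (r_right al al' (mem_head _ _) (leftmost_right_notin lm al_al') al_al').
apply/subsetP/forallP => [sub al2|all_r v vT].
  apply/implyP => /(right_of_inj al_al') <-; apply/'forall_implyP => v vT.
  by have := sub v vT; rewrite inE ltnS leq_min_entry.
rewrite inE ltnS leq_min_entry.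
by have := implyP (all_r al') al_al' => /'forall_implyP/(_ v vT).
Qed.

Lemma set_valued_strip T : strip_filling joined T boxes n = set_valued T.
Proof.
rewrite strip_filling_boxes ?boxes_leftmost //; last first.
  by move=> al al' _; rewrite mem_boxes.
rewrite /set_valued; apply/allP/and3P => [H|[/forallP ne /forallP rows _] al _].
  split.
  - by apply/forallP => al; case/andP: (H al (mem_boxes al)).
  - by apply/forallP => al; case/andP: (H al (mem_boxes al)).
  (* The column condition is vacuous, as no two boxes share a column. *)
  - apply/forallP => al; apply/forallP => al'; apply/implyP => /andP[/eqP ec /eqP er].
    by rewrite (theta_col ec) in er; lia.
by rewrite ne rows.
Qed.

Lemma mem_filling_entries T bl (e : entry n theta) :
  (e \in filling_entries T bl) = (e.2 \in bl) && (e.1 \in T e.2).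
Proof.
apply/flatten_mapP/andP => [[al al_bl /mapP[v + ->]]|[e_bl e_T]].
  by rewrite mem_rev mem_enum.
exists e.2 => //; apply/mapP; exists e.1; first by rewrite mem_rev mem_enum.
by case: e {e_bl e_T}.
Qed.

Lemma filling_entries_prec T : pairwise (@prec n theta) (filling_entries T boxes).
Proof.
case/andP: boxes_leftmost => + _; elim: boxes => //= al bl IHbl /andP[/allP al_bl p].
rewrite /filling_entries /= -/(filling_entries _ _) pairwise_cat IHbl // andbT.
apply/andP; split.
  apply/allrelP => e e' /mapP[v _ ->]; rewrite mem_filling_entries => /andP[/al_bl lt _].
  by rewrite /prec lt.
rewrite pairwise_map; have := sorted_enum_set (T al).
rewrite -rev_sorted -map_rev sorted_pairwise; last by move=> x y z; rewrite /=; lia.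
rewrite pairwise_map; apply: sub_pairwise => u v /= lt.
by rewrite /prec /= !eqxx lt !orbT.
Qed.

Lemma prec_irr (e : entry n theta) : prec e e = false.
Proof. by rewrite /prec !ltnn !andbF. Qed.

Lemma prec_asym (e e' : entry n theta) : prec e e' -> prec e' e = false.
Proof.
rewrite /prec => /or3P[lt|/andP[/eqP ec lt]|/andP[/eqP eb lt]].
- rewrite ltnNge (ltnW lt) /= ltn_eqF //=.
  by case: eqP => // eb; rewrite eb ltnn in lt.
- rewrite ec ltnn eqxx ltnNge (ltnW lt) /=.
  by case: eqP => // eb; rewrite eb ltnn in lt.
- by rewrite eb !ltnn !andbF /= ltnNge (ltnW lt) andbF.
Qed.

Lemma filling_entries_uniq T : uniq (filling_entries T boxes).
Proof.
rewrite uniq_pairwise; apply: sub_pairwise (filling_entries_prec T) => e e'.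
by apply: contraL => /eqP->; rewrite prec_irr.
Qed.

Lemma perm_filling_entries T : perm_eq (enum (entries T)) (filling_entries T boxes).
Proof.
apply: uniq_perm (enum_uniq _) (filling_entries_uniq T) _ => e.
by rewrite mem_enum inE mem_filling_entries mem_boxes.
Qed.

Lemma card_entries T : (forall al, T al != set0) ->
  (#|entries T| - #|box| = \sum_(al <- boxes) #|T al|.-1)%N.
Proof.
move=> ne; rewrite cardE (perm_size (perm_filling_entries T)) /filling_entries.
rewrite size_flatten /shape sumnE !big_map.
have -> : #|box| = size boxes by rewrite size_sort -cardE.
rewrite -sum1_size -sumnB => [|al _]; last by rewrite size_map size_rev -cardE card_gt0.
by apply: eq_bigr => al _; rewrite size_map size_rev -cardE subn1.
Qed.

Lemma set_valued_neq0 T : set_valued T -> forall al, T al != set0.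
Proof. by case/and3P => /forallP. Qed.

Section Sums.
Variables (S : Type) (A : comNzRingType) (beta : A).
Variable op : nat -> int -> (S -> A) -> S -> A.
Hypothesis op_ext : forall r c psi psi', psi =1 psi' -> op r c psi =1 op r c psi'.
Hypothesis opD : forall r c psi psi' s,
  op r c (fun s => psi s + psi' s) s = op r c psi s + op r c psi' s.
Hypothesis opZ : forall r c k psi s, op r c (fun s => k * psi s) s = k * op r c psi s.

Lemma strip_sum_tableaux D s :
  strip_sum beta n op D strip n s
  = \sum_(T : tableau n theta | set_valued T)
      beta ^+ (#|entries T| - #|box|)
      * foldr (fun (e : entry n theta) psi => op (val e.1) (content e.2) psi) D
          (filling_entries T boxes) s.
Proof.
rewrite (strip_sum_fillings beta op_ext opD opZ (@content theta) joined D s boxes_uniq (leqnn n)).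
apply: eq_big => [T|T].
  rewrite set_valued_strip andb_idl // => _.
  by apply/forallP => al; rewrite mem_boxes.
by rewrite set_valued_strip => /andP[_ /set_valued_neq0/card_entries->].
Qed.
End Sums.

Lemma Groth_strip (K : fieldType) (beta : K) (b : int -> K) :
  Groth n theta beta b
  = strip_sum (beta%:MP : {mpoly K[n]}) n
      (mul_op beta%:MP (fun k => (b k)%:MP) (@mvar K n)) (fun=> 1) strip n tt.
Proof.
rewrite strip_sum_tableaux.
- apply: eq_bigr => T _; rewrite -mul_mpolyC rmorphXn; congr (_ * _).
  rewrite -big_enum (perm_big _ (perm_filling_entries T)) /=.
  elim: filling_entries => [|e l IHl]; first by rewrite big_nil.
  by rewrite big_cons IHl /= /mul_op mvarE.
- by move=> r c psi psi' e s; rewrite /mul_op e.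
- by move=> r c psi psi' s; rewrite /mul_op mulrDr.
- by move=> r c k psi s; rewrite /mul_op mulrCA.
Qed.
End Shape.

(** * Barred entries *)

Lemma sum_subset_cons (R : nmodType) (I : finType) (i : I) (l : seq I) (F : {set I} -> R) :
  i \notin l ->
  \sum_(B : {set I} | B \subset [set x in i :: l]) F B
  = \sum_(B : {set I} | B \subset [set x in l]) (F B + F (i |: B)).
Proof.
move=> i_l; rewrite (bigID (fun B : {set I} => i \in B)) /= addrC big_split; congr (_ + _).
  apply: eq_bigl => B; apply/andP/subsetP => [[/subsetP B_l iB] x xB|B_l].
    have := B_l x xB; rewrite !inE => /orP[/eqP e|//].
    by rewrite e in xB; case/negP: iB.
  split; last by apply: contra i_l => /B_l; rewrite inE.
  by apply/subsetP => x /B_l; rewrite !inE orbC => ->.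
rewrite (reindex_onto (fun B => i |: B) (fun B => B :\ i)) /=; last first.
  by move=> B /andP[_ iB]; rewrite setD1K.
apply: eq_bigl => B; rewrite setU11 andbT.
apply/andP/subsetP => [[/subsetP B_l /eqP eB] x xB|B_l].
  have xi : x != i by apply: contraTneq xB => ->; rewrite -eB setD11.
  have : x \in i |: B by rewrite in_setU1 xB orbT.
  by move/B_l; rewrite !inE (negbTE xi).
split; last by rewrite setU1K //; apply: contra i_l => /B_l; rewrite inE.
apply/subsetP => x; rewrite !inE => /orP[->//|/B_l]; rewrite inE => ->.
by rewrite orbT.
Qed.

Section Barred.
Variables (K : fieldType) (n : nat) (theta : skew_shape).
Variables (beta : K) (a b : int -> K).
Local Notation A := {mpoly K[n]}.
Local Notation E := (entry n theta).
Implicit Types (l : seq E) (B : {set E}) (rh mu : seq nat).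

Definition labels l : seq 'I_n := [seq e.1 | e <- l].

Definition partition_chain mu (R : seq 'I_n) : bool :=
  all is_part (scanl incr_nth mu [seq val r | r <- R]).

Definition rho_before mu l (e : E) : seq nat :=
  rho mu (labels l) (count (fun e' => prec e' e) l).

Definition unbarred_weight rh (e : E) : K :=
  oplus beta (row_param n beta a rh e.1) (b (shift e)).

Definition barred_weight rh (e : E) : K :=
  (1 + beta * row_param n beta a rh e.1) * (1 + beta * b (shift e)).

(** One term in the expansion of a product of operators: the barred entries are the factors from
    which the box-adding summand was taken. *)
Definition barred_term (D : seq nat -> A) mu l B : A :=
  let l' := [seq e <- l | e \in B] in
  if partition_chain mu (labels l') then
    ((\prod_(e <- l | e \notin B) unbarred_weight (rho_before mu l' e) e)
     * (\prod_(e <- l | e \in B) barred_weight (rho_before mu l' e) e))%:MP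
    * D (foldl incr_nth mu [seq val r | r <- labels l'])
  else 0.

(** The two summands of [add_box_op] leave the first entry unbarred or bar it. In the latter case
    every later entry has one more barred predecessor, which amounts to restarting the chain at
    [incr_nth mu e.1]. *)
Lemma barred_sum D l mu : pairwise (@prec n theta) l ->
  \sum_(B : {set E} | B \subset [set e in l]) barred_term D mu l B
  = foldr (fun (e : E) psi => add_box_op beta a b (val e.1) (content e.2) psi) D l mu.
Proof.
elim: l mu => [|e l IHl] mu.
  move=> _; rewrite (big_pred1 set0) => [|B].
    by rewrite /barred_term /= !big_nil !mul1r.
  by rewrite /= -subset0; congr (_ \subset _); apply/setP => x; rewrite !inE.
move=> /= /andP[/allP e_l l_prec].
have e_notin : e \notin l by apply/negP => /e_l; rewrite prec_irr.
rewrite sum_subset_cons // big_split /=.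
have no_prec B : count (fun e' => prec e' e) [seq e' <- l | e' \in B] = 0%N.
  apply/eqP; rewrite -leqn0 leqNgt -has_count; apply/hasPn => e'.
  by rewrite mem_filter => /andP[_ /e_l /prec_asym->].
rewrite /add_box_op -!IHl // mulr_sumr; congr (_ + _).
  apply: eq_bigr => B /subsetP B_l; rewrite /barred_term /=.
  have eB : e \in B = false by apply: contraNF e_notin => /B_l; rewrite inE.
  rewrite eB !big_cons eB /=; case: ifP => _; last by rewrite mulr0.
  by rewrite {1}/rho_before no_prec -mulrA mpolyCM -mulrA /unbarred_weight /rho /= take0.
rewrite (_ : (if _ then _ else _) = \sum_(B : {set E} | B \subset [set e in l])
  if is_part (incr_nth mu e.1) then barred_term D (incr_nth mu e.1) l B else 0); last first.
  by case: ifP => // _; rewrite big1.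
rewrite mulr_sumr; apply: eq_bigr => B /subsetP B_l /=; rewrite /barred_term /=.
rewrite !inE eqxx /=.
have -> : [seq e' <- l | e' \in e |: B] = [seq e' <- l | e' \in B].
  apply: eq_in_filter => e' e'_l; rewrite in_setU1.
  by case: eqP => // ee; rewrite -ee e'_l in e_notin.
set l' := filter _ _; rewrite /partition_chain /=.
case: (is_part _) => /=; last by rewrite mulr0.
case: (all _ _); last by rewrite mulr0.
have before e' : e' \in l -> rho_before mu (e :: l') e' = rho_before (incr_nth mu e.1) l' e'.
  by move=> /e_l ee'; rewrite /rho_before /= ee' /rho /=.
have inB e' : e' \in l -> (e' \in e |: B) = (e' \in B).
  by move=> e'_l; rewrite in_setU1; case: eqP => // ee; rewrite -ee e'_l in e_notin.
rewrite !big_cons setU11 /= [RHS]mulrA -mpolyCM [_ * (_ * _) in RHS]mulrCA; congr (_%:MP * _).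
have -> : rho_before mu (e :: l') e = mu.
  by rewrite /rho_before /= prec_irr no_prec /rho take0.
congr (_ * (_ * _)); rewrite [LHS]big_seq_cond [RHS]big_seq_cond; apply: eq_big => [e'|e'].
- by apply: andb_id2l => /inB->.
- by move=> /andP[/before->].
- by apply: andb_id2l => /inB->.
- by move=> /andP[/before->].
Qed.

Hypothesis theta_col : no_two_in_column theta.

Lemma prec_trans : transitive (@prec n theta).
Proof.
move=> e2 e1 e3; rewrite /prec.
case/or3P=> [c12|/andP[/eqP c12 r12]|/andP[/eqP b12 v12]];
case/or3P=> [c23|/andP[/eqP c23 r23]|/andP[/eqP b23 v23]].
- by rewrite (ltn_trans c23 c12).
- by rewrite -c23 c12.
- by rewrite -b23 c12.
- by rewrite c12 c23.
- by rewrite c12 c23 eqxx (ltn_trans r12 r23) /= ?orbT.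
- by rewrite -b23 c12 eqxx r12 /= ?orbT.
- by rewrite b12 c23.
- by rewrite b12 c23 eqxx r23 /= ?orbT.
- by rewrite b12 b23 !eqxx (ltn_trans v23 v12) !orbT.
Qed.

(** Distinct boxes lie in distinct columns, so [prec] orders the entries totally and the sorted list
    is unique. *)
Lemma barred_seq_filter (T : tableau n theta) B : B \subset entries T ->
  barred_seq B = [seq e <- filling_entries T (boxes theta) | e \in B].
Proof.
move=> B_T; set bs := filter _ _.
have bs_prec : pairwise (@prec n theta) bs.
  by apply: pairwise_filter; apply: filling_entries_prec.
have le_trans : transitive (fun e e' : E => (e == e') || prec e e').
  move=> e2 e1 e3 /orP[/eqP->//|p12] /orP[/eqP<-|p23]; first by rewrite p12 orbT.
  by rewrite (prec_trans p12 p23) orbT.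
apply: (sorted_eq le_trans).
- move=> e e' /andP[/orP[/eqP//|p] /orP[/eqP//|p']].
  by rewrite (prec_asym p) in p'.
- apply: sort_sorted => e e'; rewrite /prec.
  have [//|neq /=] := eqVneq e e'.
  case: (ltngtP (col e.2) (col e'.2)) => //= ec; rewrite ?orbT //.
  have [eb|nb] := eqVneq e.2 e'.2; last by case/eqP: nb; apply: theta_col.
  rewrite eb ?eqxx ltnn /=; case: ltngtP => // ev; case/eqP: neq.
  by case: e e' eb ev {ec} => [v al] [v' al'] /= -> /val_inj->.
- rewrite sorted_pairwise //; apply: sub_pairwise bs_prec => e e' /= ->.
  by rewrite orbT.
- rewrite perm_sort; apply: uniq_perm; rewrite ?enum_uniq ?filter_uniq //.
    exact: filling_entries_uniq.
  move=> e; rewrite mem_enum mem_filter mem_filling_entries mem_boxes /=.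
  by rewrite andb_idr // => /(subsetP B_T); rewrite inE.
Qed.

Lemma partition_chainE (mu : part) (R : seq 'I_n) :
  all (fun i => is_part (rho mu R i)) (iota 0 (size R).+1) = partition_chain mu R.
Proof.
rewrite /partition_chain /= {1}/rho take0 /= (valP mu) /=.
apply/allP/(all_nthP [::]) => [chain i|chain i].
  rewrite size_scanl size_map => lt.
  have /chain : i.+1 \in iota 1 (size R) by rewrite mem_iota; lia.
  by rewrite nth_scanl ?size_map // /rho map_take.
rewrite mem_iota add1n; case: i => // i /= lt; rewrite ltnS in lt.
have := chain i; rewrite size_scanl size_map => /(_ lt).
by rewrite nth_scanl ?size_map // /rho map_take.
Qed.

Definition barred_labels B : seq 'I_n := [seq e.1 | e <- barred_seq B].

Lemma barred_termE D (mu : part) (T : tableau n theta) B : B \subset entries T ->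
  barred_term D mu (filling_entries T (boxes theta)) B
  = if partition_chain mu (barred_labels B) then
      (weight beta a b mu (barred_labels B) (T, B))%:MP
      * D (foldl incr_nth mu [seq val r | r <- barred_labels B])
    else 0.
Proof.
move=> B_T; rewrite /barred_term /barred_labels (barred_seq_filter B_T).
set bs := filter _ _; case: ifP => // _; congr (_%:MP * _).
have rho_atE e : rho_at mu (labels bs) B e = rho_before mu bs e.
  rewrite /rho_at /rho_before; congr rho; rewrite -sum1_card -sum1_count.
  rewrite (eq_bigl (fun e' => (e' \in B) && prec e' e)) => [|e']; last by rewrite inE.
  rewrite -big_enum_cond /=; apply: perm_big; rewrite /bs -(barred_seq_filter B_T).
  by rewrite perm_sym perm_sort.
have perm_T := perm_filling_entries theta_col T.
rewrite /weight /=; congr (_ * _).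
  rewrite -(perm_big _ perm_T) /= big_enum_cond /=.
  apply: eq_big => [e|e _]; first by rewrite in_setD andbC.
  by rewrite rho_atE.
rewrite -(perm_big _ perm_T) /= big_enum_cond /=.
apply: eq_big => [e|e _]; last by rewrite rho_atE.
by rewrite andb_idl // => /(subsetP B_T).
Qed.

Hypothesis beta_a : forall k, 1 + beta * a k != 0.

Lemma Groth_mul_alternant (mu : part) :
  Groth n theta beta b * alternant (diag_term n beta a mu)
  = \sum_(TB : tableau n theta * {set E} |
           [&& set_valued TB.1, TB.2 \subset entries TB.1
             & partition_chain mu (barred_labels TB.2)])
      (beta ^+ (#|entries TB.1| - #|box theta|)
       * weight beta a b mu (barred_labels TB.2) TB)%:MP
      * alternant (diag_term n beta a
                     (foldl incr_nth mu [seq val r | r <- barred_labels TB.2])).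
Proof.
rewrite (Groth_strip _ theta_col) strip_sum_mul_alternant //; last 2 first.
- exact: linked_strip_boxes.
- exact: valP.
rewrite (strip_sum_tableaux n theta_col); last 3 first.
- move=> r c psi psi' e rh; rewrite /add_box_op e; congr (_ + _ * _).
  by case: ifP.
- move=> r c psi psi' rh; rewrite /add_box_op mulrDr -!addrA; congr (_ + _).
  rewrite addrCA -mulrDr; congr (_ + _ * _); case: ifP => //.
  by rewrite addr0.
- move=> r c k psi rh; rewrite /add_box_op [RHS]mulrDr; congr (_ + _).
    by rewrite mulrCA.
  by case: ifP; rewrite ?mulr0 // mulrCA.
transitivity (\sum_(T : tableau n theta | set_valued T) \sum_(B : {set E} |
    (B \subset entries T) && partition_chain mu (barred_labels B))
  (beta ^+ (#|entries T| - #|box theta|) * weight beta a b mu (barred_labels B) (T, B))%:MP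
      * alternant (diag_term n beta a
                     (foldl incr_nth mu [seq val r | r <- barred_labels B]))).
  apply: eq_bigr => T _; rewrite -barred_sum; last exact: filling_entries_prec.
  rewrite mulr_sumr (eq_bigl (fun B => B \subset entries T)); last first.
    move=> B; apply: eq_subset_r => e.
    by rewrite !inE mem_filling_entries mem_boxes.
  rewrite big_mkcondr; apply: eq_bigr => B B_T; rewrite (barred_termE _ _ B_T).
  by case: ifP => _; rewrite ?mulr0 // mulrA -rmorphXn -mpolyCM.
by rewrite pair_big_dep; apply: eq_bigr => -[T B].
Qed.

Lemma sumn_incr_nth s i : sumn (incr_nth s i) = (sumn s).+1.
Proof.
elim: s i => [|x s IHs] [|i] //=; first by elim: i.
by rewrite IHs addnS.
Qed.

Lemma size_chain (mu nu : part) (R : seq 'I_n) : is_chain mu nu R ->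
  (size R <= sumn nu)%N.
Proof.
case/andP => _ /eqP <-; rewrite /rho take_size.
have -> : forall s : seq nat, sumn (foldl incr_nth s [seq val r | r <- R]) = (sumn s + size R)%N.
  elim: R => [|r R IHR] s /=; first by rewrite addn0.
  by rewrite IHR sumn_incr_nth addSnnS.
exact: leq_addl.
Qed.

(** The barred entries determine R, and [size_chain] shows that it fits into the bounded sequence
    type. *)
Lemma sum_related (mu nu : part)
    (G : seq 'I_n -> tableau n theta * {set E} -> K) :
  \sum_(RT : {bseq (sumn nu) of 'I_n} * (tableau n theta * {set E})
         | is_chain mu nu RT.1 && related RT.1 RT.2) G RT.1 RT.2
  = \sum_(TB : tableau n theta * {set E} |
           [&& set_valued TB.1, TB.2 \subset entries TB.1
             & is_chain mu nu (barred_labels TB.2)])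
      G (barred_labels TB.2) TB.
Proof.
rewrite -(pair_big_dep xpredT (fun (R : {bseq (sumn nu) of 'I_n}) TB =>
  is_chain mu nu R && related R TB) (fun R TB => G R TB)) /=.
rewrite (exchange_big_dep xpredT) //= [RHS]big_mkcond; apply: eq_bigr => TB _.
rewrite /related; case: (boolP (set_valued TB.1)) => /= _; last first.
  by rewrite big_pred0 // => R; rewrite andbF.
case: (boolP (TB.2 \subset _)) => /= _; last first.
  by rewrite big_pred0 // => R; rewrite andbF.
case: (boolP (is_chain _ _ _)) => [chain|no_chain]; last first.
  rewrite big_pred0 // => R; apply/negbTE; apply: contra no_chain.
  by move=> /andP[chain /eqP e]; rewrite /barred_labels e.
rewrite (big_pred1 (Bseq (size_chain chain))) // => R.
apply/andP/eqP => [[_ /eqP e]|-> /=]; last by rewrite chain eqxx.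
by apply: val_inj; rewrite /= -e.
Qed.
End Barred.

(** * Linear independence of the alternants *)

Section Bialternant.
Variables (R : comNzRingType) (beta : R) (a : int -> R).

Definition bialternant (k : nat) (lam : nat -> nat) (x : nat -> R) : R :=
  \det (\matrix_(i < k, j < k)
    (facpow beta a (x j) (lam i + (k - i.+1)) * (1 + beta * x j) ^+ i)).
End Bialternant.

Lemma facpow_morph (R R' : comNzRingType) (f : {rmorphism R -> R'}) (beta : R)
    (a : int -> R) x k :
  f (facpow beta a x k) = facpow (f beta) (f \o a) (f x) k.
Proof.
rewrite /facpow rmorph_prod; apply: eq_bigr => t _.
by rewrite /oplus !rmorphD !rmorphM.
Qed.

Lemma bialternant_morph (R R' : comNzRingType) (f : {rmorphism R -> R'}) (beta : R)
    (a : int -> R) k lam x :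
  f (bialternant beta a k lam x) = bialternant (f beta) (f \o a) k lam (f \o x).
Proof.
rewrite /bialternant -det_map_mx; congr (\det _); apply/matrixP => i j.
by rewrite !mxE rmorphM facpow_morph rmorphXn rmorphD rmorphM rmorph1.
Qed.

Lemma eq_part (s t : part) : (forall i, nth 0%N s i = nth 0%N t i) -> s = t.
Proof.
move=> e; apply/val_inj/(@eq_from_nth _ 0%N) => [|i _]; last exact: e.
wlog lt : s t e / (size s < size t)%N.
  move=> H; have [lt|gt|//] := ltngtP (size s) (size t); first exact: H.
  by symmetry; apply: H => // i; rewrite e.
have /is_partP[_ /(_ _ lt)] := valP t.
by rewrite -e nth_default.
Qed.

Lemma sumn_nth (s : seq nat) N : (size s <= N)%N -> sumn s = \sum_(i < N) nth 0%N s i.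
Proof.
move=> le; rewrite sumnE (big_nth 0%N) big_mkord (big_ord_widen N (nth 0%N s)) //.
rewrite big_mkcond; apply: eq_bigr => i _; case: ltnP => // ge.
by rewrite nth_default.
Qed.

Lemma card_ord_lt n m : (m <= n)%N -> #|[set j : 'I_n | (j < m)%N]| = m.
Proof.
move=> m_n; rewrite -sum1_card (eq_bigl (fun j : 'I_n => (j < m)%N)); last first.
  by move=> j; rewrite inE.
by rewrite -(big_ord_widen n (fun=> 1%N)) // sum1_card card_ord.
Qed.

Section Independence.
Variables (K : fieldType) (n : nat) (beta : K) (a : int -> K).
Hypothesis beta_a : forall k, 1 + beta * a k != 0.
Hypothesis a_inj : injective a.
Local Notation A := {mpoly K[n]}.
Local Notation D lam := (alternant (diag_term n beta a lam)).

Lemma alternant_diag_term lam :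
  D lam = bialternant (beta%:MP : A) (fun k => (a k)%:MP) n (nth 0%N lam) (@mvar K n).
Proof.
rewrite /bialternant /alternant /determinant; apply: eq_bigr => sg _; congr (_ * _).
rewrite rmorph_prod; apply: eq_bigr => i _; rewrite mxE mvarE /=.
rewrite msymM rmorphXn /= msymD msymM msymC msymXi msym1; congr (_ * _).
rewrite (facpow_morph (msym sg)) /= msymC msymXi.
by rewrite /facpow; apply: eq_bigr => t _ /=; rewrite msymC.
Qed.

Lemma meval_alternant (v : nat -> K) lam :
  (D lam).@[fun i : 'I_n => v i] = bialternant beta a n (nth 0%N lam) v.
Proof.
rewrite alternant_diag_term (bialternant_morph (meval (fun i : 'I_n => v i))) /=.
rewrite /bialternant mevalC; congr (\det _); apply/matrixP => i j.
rewrite !mxE /= mvarE mevalXU; congr (_ * _); rewrite /facpow.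
by apply: eq_bigr => t _; rewrite /= mevalC.
Qed.

Lemma oplus_ominus p q : oplus beta (ominus beta p) q = 0 -> 1 + beta * p != 0 -> p = q.
Proof.
rewrite /oplus /ominus => e nz.
have : (q - p) / (1 + beta * p) = 0 by rewrite -e; field.
move/eqP; rewrite mulf_eq0 invr_eq0 (negbTE nz) orbF subr_eq0.
by move/eqP.
Qed.

(** At ⊖a_p the factor x ⊕ a_t vanishes only for t = p, since a is injective; the factorial power
    contains t = 1, .., m. *)
Lemma facpow_row_param_eq0 (mu : seq nat) j m : (j < n)%N ->
  (facpow beta a (row_param n beta a mu j) m == 0) = (n - j + nth 0%N mu j <= m)%N.
Proof.
move=> j_n; have -> : (n - j + nth 0%N mu j = (n - j.+1 + nth 0%N mu j).+1)%N by lia.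
apply/idP/idP => [|lt].
  rewrite /facpow prodf_seq_eq0 => /hasP[t _ /= /eqP /oplus_ominus].
  move=> /(_ (beta_a _)) /a_inj [e]; have := ltn_ord t; lia.
rewrite /facpow (bigD1 (Ordinal lt)) //= mulf_eq0; apply/orP; left.
rewrite /row_param (_ : (n - j + _ = (n - j.+1 + nth 0%N mu j).+1)%N); last lia.
have nz := beta_a (n - j.+1 + nth 0%N mu j).+1.
by rewrite /oplus /ominus; apply/eqP; field.
Qed.

Lemma bialternant_vanish (lam mu : part) i : (i < n)%N ->
  (nth 0%N mu i < nth 0%N lam i)%N ->
  bialternant beta a n (nth 0%N lam) (row_param n beta a mu) = 0.
Proof.
move=> i_n lt; rewrite /bialternant /determinant big1 // => sg _.
(* Otherwise [sg] would map the i + 1 indices up to i injectively into the i indices below i. *)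
have [j /andP[j_i sg_j]] : exists j : 'I_n, (j <= i)%N && (i <= sg j)%N.
  case: (boolP [exists j : 'I_n, (j <= i)%N && (i <= sg j)%N]) => [/existsP//|/existsPn all_lt].
  exfalso.
  have: (#|[set j : 'I_n | (j < i.+1)%N]| <= #|[set j : 'I_n | (j < i)%N]|)%N.
    rewrite -(card_imset _ (@perm_inj _ sg)); apply: subset_leq_card.
    apply/subsetP => _ /imsetP[j + ->]; rewrite !inE ltnS => j_i.
    by have := all_lt j; rewrite j_i /= -ltnNge.
  by rewrite !card_ord_lt ?(ltnW i_n) // ltnn.
rewrite (bigD1 j) //= mxE (_ : facpow _ _ _ _ = 0) ?mul0r ?mulr0 //.
apply/eqP; rewrite facpow_row_param_eq0 //.
have := part_nth_leq mu sg_j; have := part_nth_leq lam j_i; have := ltn_ord (sg j); lia.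
Qed.

(** At this point the matrix is lower triangular with nonzero diagonal. *)
Lemma bialternant_row_param_neq0 (lam : part) :
  bialternant beta a n (nth 0%N lam) (row_param n beta a lam) != 0.
Proof.
rewrite /bialternant det_trig; last first.
  apply/is_trig_mxP => i j lt; rewrite mxE (_ : facpow _ _ _ _ = 0) ?mul0r //.
  apply/eqP; rewrite facpow_row_param_eq0 //.
  by have := part_nth_leq lam (ltnW lt); have := ltn_ord j; lia.
apply/prodf_neq0 => i _; rewrite mxE mulf_neq0 //.
  by rewrite facpow_row_param_eq0 // -ltnNge; have := ltn_ord i; lia.
rewrite expf_neq0 // /row_param /ominus; set p := a _.
have nz : 1 + beta * p != 0 := beta_a _.
have -> : 1 + beta * (- p / (1 + beta * p)) = (1 + beta * p)^-1 by field.
by rewrite invr_eq0.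
Qed.

(** By induction on the size of [lam], evaluate at a_lam: smaller partitions already have
    coefficient 0, and any other partition not contained in [lam] gives 0. A partition of at least
    the same size contained in [lam] is [lam] itself. *)
Lemma alternant_free (s : seq part) (h : part -> K) :
  uniq s -> (forall lam, lam \in s -> (size lam <= n)%N) ->
  \sum_(lam <- s) (h lam)%:MP * D lam = 0 -> forall lam, lam \in s -> h lam = 0.
Proof.
move=> s_uniq s_size sum0 lam; have [m] := ubnP (sumn lam).
elim: m lam => // m IHm lam lt lam_s.
have := congr1 (meval (fun i : 'I_n => row_param n beta a lam i)) sum0.
rewrite meval0 raddf_sum /= (bigD1_seq lam) //= mevalM mevalC meval_alternant.
rewrite big_seq_cond big1 => [|ka /andP[ka_s neq]].
  rewrite addr0 => /eqP; rewrite mulf_eq0 (negbTE (bialternant_row_param_neq0 lam)) orbF.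
  by move/eqP.
rewrite mevalM mevalC meval_alternant.
have [lt'|ge] := ltnP (sumn ka) (sumn lam).
  by rewrite IHm ?mul0r //; apply: leq_trans lt' _.
have [/existsP[i lt_i]|/existsPn le] := boolP [exists i : 'I_n, (nth 0 lam i < nth 0 ka i)%N].
  by rewrite (bialternant_vanish (ltn_ord i)) ?mulr0.
case/eqP: neq; apply: eq_part => i.
have [i_n|n_i] := ltnP i n; last by rewrite !nth_default // (leq_trans _ n_i) ?s_size.
move: ge; rewrite !(@sumn_nth _ n) ?s_size // => ge.
have le' (j : 'I_n) : true -> (nth 0 ka j <= nth 0 lam j ?= iff (nth 0 ka j == nth 0 lam j))%N.
  by move=> _; apply/leqifP; case: eqP => // /eqP ne; rewrite ltn_neqAle ne leqNgt le.
have := leqif_sum le'; case=> leS; rewrite eqn_leq leS ge => /esym/forallP/(_ (Ordinal i_n)).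
by move/eqP.
Qed.
End Independence.

(** * Branching of the bialternant *)

Section Branching.
Variables (R : idomainType) (beta : R) (a : int -> R).
Local Notation "x ⊕ y" := (oplus beta x y) (at level 50).
Local Notation P := (facpow beta a).

(** The branching of a single row. The induction on L uses (1 + beta y)(y ⊕ c) + (x - y)(1 + beta (y
    ⊕ c)) = (1 + beta y)(x ⊕ c). *)
Lemma interpolate_facpow (x y : R) A L :
  (x - y) * \sum_(m < L.+1) P x (A + m)
     * ((\prod_(m <= t < L) (y ⊕ a (A + t).+2))
        * (if (0 < m)%N then 1 + beta * (y ⊕ a (A + m).+1) else 1))
  = (1 + beta * y) * P x (A + L).+1
    - (1 + beta * x) * P x A * \prod_(t < L.+1) (y ⊕ a (A + t).+1).
Proof.
elim: L => [|L IHL].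
  rewrite !big_ord1 big_geq // mulr1 mulr1 addn0 facpowS /oplus; ring.
rewrite big_ord_recr /= big_geq // mul1r.
rewrite [X in _ * (X + _)](_ : _ = (\sum_(m < L.+1) P x (A + m)
     * ((\prod_(m <= t < L) (y ⊕ a (A + t).+2))
        * (if (0 < m)%N then 1 + beta * (y ⊕ a (A + m).+1) else 1))) * (y ⊕ a (A + L).+2)).
  rewrite mulrDr mulrA IHL [in RHS]big_ord_recr /= [in RHS]addnS [in RHS]facpowS.
  rewrite !addnS; set p := P x _; set q := P x A; set pr := \prod_(_ < _) _.
  by rewrite /oplus; ring.
rewrite mulr_suml; apply: eq_bigr => m _; rewrite big_nat_recr /=; last by rewrite -ltnS.
by rewrite -!mulrA [_ * (y ⊕ _)]mulrC.
Qed.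

Section Step.
Variables (k : nat) (lam : nat -> nat) (N : nat) (x : nat -> R).
Hypothesis lam_dec : forall i, (lam i.+1 <= lam i)%N.
Hypothesis lam_N : (lam 0%N < N)%N.
Let y := x k.
Hypothesis y_reg : 1 + beta * y != 0.

(* In [p = (m, c)], [m] is the length of row [i] of the shape occupied by
   values smaller than [k], and [c] tells whether [k] also occurs in the last
   box of that row. *)
Definition row_choice (i : nat) (p : 'I_N * bool) : bool :=
  [&& (lam i.+1 <= p.1)%N, (p.1 <= lam i)%N & p.2 ==> (lam i.+1 < p.1)%N].

(** The value k is k + 1 when counted from 1, so in the box (i, t) its parameter has index t + (k -
    i) + 1. The shared box is in column m - 1, which lowers the index by one. *)
Definition row_weight (i : nat) (p : 'I_N * bool) : R :=
  (\prod_(p.1 <= t < lam i) (y ⊕ a (t + (k - i)).+1))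
  * (if p.2 then beta * (y ⊕ a (p.1 + (k - i))%N) else 1).

Definition branch_term (i : nat) (z : R) : R :=
  \sum_(p : 'I_N * bool | row_choice i p)
    row_weight i p * (P z (p.1 + (k - i.+1)) * (1 + beta * z) ^+ i).

Definition bialt_term (i : nat) (z : R) : R :=
  P z (lam i + (k.+1 - i.+1)) * (1 + beta * z) ^+ i.

Lemma lam_leN i : (lam i < N)%N.
Proof.
apply: leq_ltn_trans lam_N; elim: i => // i; exact: leq_trans.
Qed.

Lemma branch_termE i z : (i < k)%N ->
  branch_term i z = (\sum_(m < (lam i - lam i.+1).+1) P z (lam i.+1 + (k - i.+1) + m)
     * ((\prod_(m <= t < lam i - lam i.+1) (y ⊕ a (lam i.+1 + (k - i.+1) + t).+2))
        * (if (0 < m)%N then 1 + beta * (y ⊕ a (lam i.+1 + (k - i.+1) + m).+1) else 1)))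
     * (1 + beta * z) ^+ i.
Proof.
move=> i_k; rewrite /branch_term.
transitivity (\sum_(m : 'I_N | (lam i.+1 <= m <= lam i)%N)
  (\prod_(m <= t < lam i) (y ⊕ a (t + (k - i)).+1))
  * (if (lam i.+1 < m)%N then 1 + beta * (y ⊕ a (m + (k - i))%N) else 1)
  * (P z (m + (k - i.+1)) * (1 + beta * z) ^+ i)).
  rewrite (eq_bigl (fun p : 'I_N * bool => (lam i.+1 <= p.1 <= lam i)%N
             && (p.2 ==> (lam i.+1 < p.1)%N))); last by move=> p; rewrite /row_choice andbA.
  rewrite -(pair_big_dep (fun m : 'I_N => (lam i.+1 <= m <= lam i)%N)
     (fun m c => c ==> (lam i.+1 < m)%N) (fun m c => row_weight i (m, c) *
       (P z (m + (k - i.+1)) * (1 + beta * z) ^+ i))) /=.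
  apply: eq_bigr => m _; rewrite -mulr_suml; congr (_ * _).
  rewrite /row_weight /= -mulr_sumr; congr (_ * _).
  rewrite big_mkcond big_bool /=; case: ltnP => _ /=; first by rewrite addrC.
  by rewrite add0r.
rewrite mulr_suml.
pose F (m : nat) := (\prod_(m <= t < lam i) (y ⊕ a (t + (k - i)).+1))
  * (if (lam i.+1 < m)%N then 1 + beta * (y ⊕ a (m + (k - i))%N) else 1)
  * (P z (m + (k - i.+1)) * (1 + beta * z) ^+ i).
transitivity (\sum_(lam i.+1 <= m < (lam i).+1) F m).
  rewrite -(big_mkord (fun m => (lam i.+1 <= m <= lam i)%N) F).
  rewrite (big_cat_nat (n := (lam i).+1)) //=; last exact: lam_leN.
  rewrite [X in _ + X]big_nat_cond [X in _ + X]big_pred0 ?addr0; last by move=> m; lia.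
  rewrite (big_cat_nat (n := lam i.+1)) //=; last by apply: leqW.
  rewrite big_nat_cond big_pred0 ?add0r; last by move=> m; lia.
  by rewrite big_nat_cond [RHS]big_nat_cond; apply: eq_bigl => m; lia.
rewrite -{1}[lam i.+1]add0n big_addn big_mkord subSn //.
apply: eq_bigr => m _; rewrite /F.
rewrite big_addn [LHS]mulrA [X in X * _ = _]mulrC.
have -> : (m + lam i.+1 + (k - i.+1) = lam i.+1 + (k - i.+1) + m)%N by lia.
have -> : (lam i.+1 < m + lam i.+1)%N = (0 < m)%N by lia.
have -> : (m + lam i.+1 + (k - i) = (lam i.+1 + (k - i.+1) + m).+1)%N by lia.
by rewrite (eq_bigr (fun t => y ⊕ a (lam i.+1 + (k - i.+1) + t).+2)) // => t _;
  congr (_ ⊕ a _%:Z); lia.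
Qed.

Lemma branch_term_diff i z : (i < k)%N ->
  (z - y) * branch_term i z
  = (1 + beta * y) * bialt_term i z
    - (\prod_(t < (lam i - lam i.+1).+1) (y ⊕ a (lam i.+1 + (k - i.+1) + t).+1))
      * bialt_term i.+1 z.
Proof.
move=> i_k; rewrite branch_termE // mulrA interpolate_facpow /bialt_term.
have -> : (lam i.+1 + (k - i.+1) + (lam i - lam i.+1)).+1 = (lam i + (k.+1 - i.+1))%N.
  by have := lam_dec i; lia.
rewrite subSS exprS; set p := P z _; set q := P z _; set u := (1 + _) ^+ i.
by set pr := \prod_(_ < _) _; ring.
Qed.

(** By [branch_term_diff], the bidiagonal matrix [U] turns each row but the last into multiples x_j
    - y of branched entries, and these vanish in the last column, where x_k = y. Expanding along
    that column leaves the branched minor; the power of 1 + beta y in its corner entry cancels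
    against det U. *)
Lemma bialternant_step :
  bialternant beta a k.+1 lam x
  = P y (lam k) * (\prod_(j < k) (x j - y))
    * \det (\matrix_(i < k, j < k) branch_term i (x j)).
Proof.
pose d i := \prod_(t < (lam i - lam i.+1).+1) (y ⊕ a (lam i.+1 + (k - i.+1) + t).+1).
pose M := \matrix_(i < k.+1, j < k.+1) bialt_term i (x j).
pose U := \matrix_(i < k.+1, j < k.+1)
  (if j == i then (if (i < k)%N then 1 + beta * y else 1)
   else if j == i.+1 :> nat then - d i else 0).
have detU : \det U = (1 + beta * y) ^+ k.
  rewrite -det_tr det_trig.
    rewrite big_ord_recr /= !mxE eqxx ltnn mulr1 -[in RHS](card_ord k) -prodr_const.
    by apply: eq_bigr => i _; rewrite !mxE eqxx /= ltn_ord.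
  apply/is_trig_mxP => i j lt; rewrite !mxE.
  by rewrite -val_eqE /= (ltn_eqF lt) (ltn_eqF (leqW lt)).
have UM i j : (U *m M) i j = if (i < k)%N then (x j - y) * branch_term i (x j)
                             else bialt_term i (x j).
  rewrite mxE (bigD1 i) //= !mxE eqxx; case: ltnP => [i_k|k_i].
    rewrite branch_term_diff //; congr (_ + _).
    have Si_k : (i.+1 < k.+1)%N by [].
    rewrite (bigD1 (Ordinal Si_k)) /=; last by rewrite -val_eqE /= gtn_eqF.
    rewrite !mxE -val_eqE /= gtn_eqF // eqxx mulNr big1 ?addr0 // => l /andP[li lSi].
    rewrite !mxE (negbTE li) (_ : _ == _ = false) ?mul0r //.
    exact: negbTE lSi.
  rewrite mul1r big1 ?addr0 // => l li; rewrite !mxE (negbTE li).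
  by rewrite ltn_eqF ?mul0r // ltnS (leq_trans _ k_i) // -ltnS.
have : \det (U *m M) = (1 + beta * y) ^+ k * \det M by rewrite det_mulmx detU.
rewrite (expand_det_col _ ord_max) (bigD1 ord_max) //= big1 => [|i im]; last first.
  rewrite UM -/y subrr mul0r ifT ?mul0r //.
  by rewrite ltn_neqAle -ltnS ltn_ord andbT; apply: contra im => /eqP e; apply/eqP/val_inj.
rewrite addr0 UM /= ltnn /cofactor -signr_odd addnn odd_double mul1r.
have -> : row' ord_max (col' ord_max (U *m M))
  = (\matrix_(i < k, j < k) branch_term i (x j)) *m diag_mx (\row_(j < k) (x j - y)).
  apply/matrixP => i j; rewrite mul_mx_diag [LHS]mxE [LHS]mxE UM !lift_max ltn_ord !mxE.
  by rewrite mulrC.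
rewrite det_mulmx det_diag /bialt_term subnn addn0 -/y => e.
apply: (mulfI (expf_neq0 k y_reg)); rewrite -[bialternant _ _ _ _ _]/(\det M) -e.
rewrite (eq_bigr (fun j : 'I_k => x j - y)) => [|j _]; last by rewrite mxE.
by ring.
Qed.

(** The determinant is multilinear in its rows, so the choices in the different rows are
    independent. *)
Lemma bialternant_branch :
  bialternant beta a k.+1 lam x
  = P y (lam k) * (\prod_(j < k) (x j - y))
    * \sum_(f : {ffun 'I_k -> 'I_N * bool} | [forall i : 'I_k, row_choice i (f i)])
        (\prod_(i < k) row_weight i (f i))
        * bialternant beta a k (fun i => if insub i is Some j then (f j).1 else 0%N) x.
Proof.
rewrite bialternant_step; congr (_ * _).
rewrite /determinant; under eq_bigr => sg _.
  rewrite (eq_bigr (fun i : 'I_k => \sum_(p : 'I_N * bool | row_choice i p) row_weight i p *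
     (P (x (sg i)) (p.1 + (k - i.+1)) * (1 + beta * x (sg i)) ^+ i))); last first.
    by move=> i _; rewrite mxE.
  rewrite bigA_distr_big_dep /= mulr_sumr.
  over.
rewrite exchange_big /=; apply: eq_big => [f|f _]; last first.
  rewrite mulr_sumr; apply: eq_bigr => sg _; rewrite big_split /= mulrCA.
  congr (_ * (_ * _)); apply: eq_bigr => i _; rewrite mxE valK //.
by apply/familyP/forallP.
Qed.
End Step.
End Branching.

(** * Removing the largest value from a tableau *)

Lemma initial_segment n (Q : pred 'I_n) :
  (forall j j' : 'I_n, j' = j.+1 :> nat -> Q j' -> Q j) ->
  forall j, Q j = (j < #|[set j | Q j]|)%N.
Proof.
move=> Q_step.
have Q_down d : forall j j' : 'I_n, j' = (j + d)%N :> nat -> Q j' -> Q j.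
  elim: d => [|d IHd] j j'; first by rewrite addn0 => /val_inj->.
  move=> e Qj'; have lt : (j + d < n)%N by apply: leq_ltn_trans (ltn_ord j'); lia.
  by apply: (IHd _ (Ordinal lt)) => //; apply: Q_step Qj' => /=; lia.
move=> j; apply/idP/idP => [Qj|].
  rewrite -{1}(card_ord_lt (ltn_ord j)) subset_leq_card //; apply/subsetP => j'.
  by rewrite !inE ltnS => le; apply: (Q_down (j - j')%N) Qj; lia.
apply: contraLR => nQ; rewrite -leqNgt -[X in (_ <= X)%N](card_ord_lt (ltnW (ltn_ord j))).
apply: subset_leq_card; apply/subsetP => j'; rewrite !inE ltnNge => Qj'.
by apply: contra nQ => le; apply: (Q_down (j' - j)%N) Qj'; lia.
Qed.

Section GridTableaux.
Variables (n w : nat).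
Local Notation filling := {ffun 'I_n * 'I_w -> {set 'I_n}}.
Implicit Types (T : filling) (lam : nat -> nat) (k : nat).

(** Empty sets outside the shape keep all shapes on one fixed index type, so that removing the
    largest value may change the shape. *)
Definition grid_tableau k lam T : bool :=
  [&& [forall p, (T p != set0) == (p.2 < lam p.1)%N],
      [forall p, T p \subset below n k],
      [forall p : 'I_n * 'I_w, forall p' : 'I_n * 'I_w, (p'.1 == p.1) && (p'.2 == p.2.+1 :> nat) ==>
         [forall v in T p, forall v' in T p', (v <= v')%N]] &
      [forall p : 'I_n * 'I_w, forall p' : 'I_n * 'I_w, (p'.2 == p.2) && (p'.1 == p.1.+1 :> nat) ==>
         [forall v in T p, forall v' in T p', (v < v')%N]]].

Lemma grid_tableauP k lam T :
  reflect [/\ forall i j, (T (i, j) != set0) = (j < lam i)%N,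
              forall i j (v : 'I_n), v \in T (i, j) -> (v < k)%N,
              forall i (j j' : 'I_w) (v v' : 'I_n), j' = j.+1 :> nat ->
                v \in T (i, j) -> v' \in T (i, j') -> (v <= v')%N
            & forall (i i' : 'I_n) j (v v' : 'I_n), i' = i.+1 :> nat ->
                v \in T (i, j) -> v' \in T (i', j) -> (v < v')%N]
          (grid_tableau k lam T).
Proof.
apply: (iffP and4P) => [[/forallP ne /forallP lt_k /forallP rows /forallP cols]
                       |[ne lt_k rows cols]].
  split=> [i j|i j v vT|i j j' v v' e vT v'T|i i' j v v' e vT v'T].
  - exact: eqP (ne (i, j)).
  - by have := subsetP (lt_k (i, j)) v vT; rewrite inE.
  - have /forallP/(_ (i, j')) := rows (i, j).
    by rewrite e !eqxx => /'forall_implyP/(_ v vT)/'forall_implyP/(_ v' v'T).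
  - have /forallP/(_ (i', j)) := cols (i, j).
    by rewrite e !eqxx => /'forall_implyP/(_ v vT)/'forall_implyP/(_ v' v'T).
split.
- by apply/forallP => -[i j]; rewrite ne.
- by apply/forallP => -[i j]; apply/subsetP => v /lt_k; rewrite inE.
- apply/forallP => -[i j]; apply/forallP => -[i' j']; apply/implyP => /= /andP[/eqP-> /eqP e].
  by apply/'forall_implyP => v vT; apply/'forall_implyP => v' v'T; apply: rows e vT v'T.
- apply/forallP => -[i j]; apply/forallP => -[i' j']; apply/implyP => /= /andP[/eqP-> /eqP e].
  by apply/'forall_implyP => v vT; apply/'forall_implyP => v' v'T; apply: cols e vT v'T.
Qed.

Lemma grid_tableau_row k lam T (i : 'I_n) j (v : 'I_n) : (forall i, lam i.+1 <= lam i)%N ->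
  grid_tableau k lam T -> v \in T (i, j) -> (i <= v)%N.
Proof.
move=> lam_dec /grid_tableauP[ne _ _ cols]; case: i v => i.
elim: i => // i IHi i_n v vT; have i_n' := ltnW i_n.
have : T (Ordinal i_n', j) != set0.
  by rewrite ne (leq_trans _ (lam_dec _)) // -(ne (Ordinal i_n)); apply/set0Pn; exists v.
case/set0Pn => u uT; apply: leq_ltn_trans (IHi i_n' u uT) _ => /=.
exact: cols uT vT.
Qed.

Section Step.
Variables (k : nat) (lam : nat -> nat).
Hypothesis k_n : (k < n)%N.
Hypothesis lam_dec : forall i, (lam i.+1 <= lam i)%N.
Hypothesis lam_w : (lam 0%N <= w)%N.
Hypothesis lam_k : forall i, (k < i)%N -> lam i = 0%N.
Local Notation choice := {ffun 'I_k -> 'I_w.+1 * bool}.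
Local Notation vk := (Ordinal k_n).

(** Rows from k on have length 0, because values below k can fill at most k rows of a column. *)
Definition inner_len (f : choice) (i : nat) : nat :=
  if insub i is Some j then (f j).1 else 0%N.
Definition shares_last (f : choice) (i : nat) : bool :=
  if insub i is Some j then (f j).2 else false.

Definition has_max (f : choice) (p : 'I_n * 'I_w) : bool :=
  (p.2 < lam p.1)%N &&
  ((inner_len f p.1 <= p.2)%N || shares_last f p.1 && (p.2.+1 == inner_len f p.1)).

Definition add_max (fT : choice * filling) : filling :=
  [ffun p => if has_max fT.1 p then vk |: fT.2 p else fT.2 p].

(** Counting gives the length because these cells form an initial segment of the row ([lowE]). *)
Definition low_len T (i : 'I_n) : nat :=
  #|[set j : 'I_w | T (i, j) :&: below n k != set0]|.

Definition remove_max T : choice * filling :=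
  ([ffun i : 'I_k => let i' := widen_ord (ltnW k_n) i in
      (inord (low_len T i'),
       [exists j : 'I_w, (j.+1 == low_len T i') && (vk \in T (i', j))])],
   [ffun p => T p :&: below n k]).

Definition choice_ok (f : choice) := [forall i : 'I_k, row_choice lam i (f i)].

Lemma low_len_w T i : (low_len T i < w.+1)%N.
Proof. by rewrite ltnS -[X in (_ <= X)%N]card_ord max_card. Qed.

Lemma lam_leq_w i : (lam i <= w)%N.
Proof. by apply: leq_trans lam_w; elim: i => // i; apply: leq_trans. Qed.

Section Removal.
Variable T : filling.
Hypothesis T_tab : grid_tableau k.+1 lam T.
Let f := (remove_max T).1.

Let lowE i j : (T (i, j) :&: below n k != set0) = (j < low_len T i)%N.
Proof.
case/grid_tableauP: T_tab => ne _ rows _.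
apply: (initial_segment (Q := fun j => T (i, j) :&: below n k != set0)) => {}j j' e.
case/set0Pn => v'; rewrite !inE => /andP[v'T v'_k].
have : T (i, j) != set0.
  rewrite ne ltnW // -e -ne; by apply/set0Pn; exists v'.
case/set0Pn => v vT; apply/set0Pn; exists v; rewrite !inE vT.
exact: leq_ltn_trans (rows _ _ _ _ _ e vT v'T) v'_k.
Qed.

Let inner_lenE (i : 'I_n) : inner_len f i = low_len T i.
Proof.
rewrite /inner_len; case: insubP => [i' _ ei|].
  rewrite ffunE /= inordK; last exact: low_len_w.
  by congr low_len; apply: val_inj.
rewrite -leqNgt => k_i; apply/esym/eqP; rewrite -leqn0 leqNgt; apply/negP => lt.
have w_gt0 : (0 < w)%N by rewrite -ltnS (leq_ltn_trans lt) ?low_len_w.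
have : (T (i, Ordinal w_gt0) :&: below n k != set0) by rewrite lowE.
case/set0Pn => v; rewrite !inE => /andP[/(grid_tableau_row lam_dec T_tab) le].
by rewrite ltnNge (leq_trans k_i).
Qed.

Let vk_low i j : vk \in T (i, j) -> (low_len T i <= j.+1)%N.
Proof.
case/grid_tableauP: (T_tab) => _ _ rows _ vkT; rewrite leqNgt; apply/negP => lt.
have j_w : (j.+1 < w)%N by rewrite (leq_trans lt) // -ltnS low_len_w.
have : T (i, Ordinal j_w) :&: below n k != set0 by rewrite lowE.
case/set0Pn => v; rewrite !inE => /andP[vT].
by rewrite ltnNge (rows _ _ _ _ _ _ vkT vT).
Qed.

Lemma remove_max_choice : choice_ok f.
Proof.
case/grid_tableauP: (T_tab) => ne lt_k rows cols.
apply/forallP => i; pose i1 := widen_ord (ltnW k_n) i.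
have Si_n : (i.+1 < n)%N by apply: leq_trans k_n; rewrite ltnS.
pose i2 := Ordinal Si_n.
rewrite /row_choice ffunE /= inordK ?low_len_w // -/i1.
(* A box with another box below it has all its values under some value at most k, so it belongs to
   the inner shape. *)
have le1 : (lam i.+1 <= low_len T i1)%N.
  rewrite leqNgt; apply/negP => lt.
  have j_w : (low_len T i1 < w)%N by rewrite (leq_trans lt) ?lam_leq_w.
  pose j := Ordinal j_w.
  have : T (i2, j) != set0 by rewrite ne.
  case/set0Pn => v' v'T.
  have : T (i1, j) != set0 by rewrite ne (leq_trans lt) ?lam_dec.
  case/set0Pn => v vT.
  have : (j < low_len T i1)%N.
    rewrite -lowE; apply/set0Pn; exists v; rewrite !inE vT /=.
    have := cols i1 i2 j v v' erefl vT v'T; have := lt_k _ _ _ v'T; lia.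
  by rewrite ltnn.
rewrite le1 /=; apply/andP; split.
  rewrite leqNgt; apply/negP => lt.
  have j_w : (lam i < w)%N by rewrite (leq_trans lt) // -ltnS low_len_w.
  have : T (i1, Ordinal j_w) :&: below n k != set0 by rewrite lowE.
  case/set0Pn => v; rewrite inE => /andP[vT _].
  have : T (i1, Ordinal j_w) != set0 by apply/set0Pn; exists v.
  by rewrite ne /= ltnn.
apply/implyP => /existsP[j /andP[/eqP ej vkT]]; rewrite ltn_neqAle le1 andbT.
apply/eqP => e.
have : T (i2, j) != set0 by rewrite ne /= e -ej.
case/set0Pn => v' v'T; have := cols i1 i2 j vk v' erefl vkT v'T.
by have := lt_k _ _ _ v'T; rewrite /=; lia.
Qed.

Lemma remove_max_tableau : grid_tableau k (inner_len f) (remove_max T).2.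
Proof.
case/grid_tableauP: (T_tab) => ne lt_k rows cols.
apply/grid_tableauP; split=> [i j|i j v|i j j' v v' e|i i' j v v' e]; rewrite ?ffunE.
- by rewrite lowE inner_lenE.
- by rewrite !inE => /andP[].
- by rewrite !inE => /andP[vT _] /andP[v'T _]; apply: rows e vT v'T.
- by rewrite !inE => /andP[vT _] /andP[v'T _]; apply: cols e vT v'T.
Qed.

Lemma remove_maxK : add_max (remove_max T) = T.
Proof.
case/grid_tableauP: (T_tab) => ne lt_k rows cols.
have vkE i j : (vk \in T (i, j)) = has_max f (i, j).
  rewrite /has_max /= inner_lenE; apply/idP/andP => [vkT|[j_lam]].
    have j_lam : (j < lam i)%N by rewrite -ne; apply/set0Pn; exists vk.
    split=> //; case: leqP => //= lt.
    have ej : j.+1 = low_len T i by apply/eqP; rewrite eqn_leq lt vk_low.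
    rewrite ej eqxx andbT /shares_last; case: insubP => [i' _ ei|].
      rewrite ffunE /=; have -> : widen_ord (ltnW k_n) i' = i by apply: val_inj.
      by apply/existsP; exists j; rewrite ej eqxx.
    by move=> k_i; have := inner_lenE i; rewrite /inner_len insubN // -ej.
  case/orP => [ge|/andP[]].
    have : T (i, j) != set0 by rewrite ne.
    case/set0Pn => v vT; suff <- : v = vk by [].
    apply: val_inj; apply/eqP; rewrite eqn_leq -ltnS (lt_k _ _ _ vT) /= leqNgt.
    apply/negP => v_k; have : (j < low_len T i)%N.
      by rewrite -lowE; apply/set0Pn; exists v; rewrite !inE vT.
    by rewrite ltnNge ge.
  rewrite /shares_last; case: insubP => // i' _ ei; rewrite ffunE /=.
  have -> : widen_ord (ltnW k_n) i' = i by apply: val_inj.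
  by case/existsP => j' /andP[/eqP <- vkT] /eqP[/val_inj->].
apply/ffunP => -[i j]; rewrite ffunE -/f -vkE ffunE; apply/setP => v.
have [->|neq] := eqVneq v vk.
  case: (boolP (vk \in T (i, j))) => _; first by rewrite setU11.
  by rewrite !inE ltnn andbF.

have -> : (v \in if vk \in T (i, j) then vk |: T (i, j) :&: below n k else T (i, j) :&: below n k)
  = (v \in T (i, j)) && (v < k)%N.
  by case: ifP; rewrite !inE // (negbTE neq).
apply: andb_idr => /lt_k; rewrite ltnS leq_eqVlt => /orP[/eqP e|//].
by case/eqP: neq; apply: val_inj.
Qed.
End Removal.

Lemma choice_okP f i : choice_ok f ->
  [/\ (lam i.+1 <= inner_len f i)%N, (inner_len f i <= lam i)%N
    & shares_last f i -> (lam i.+1 < inner_len f i)%N].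
Proof.
rewrite /inner_len /shares_last => f_ok; case: insubP => [i' _ <-|k_i].
  by have /and3P[? ? /implyP] := forallP f_ok i'.
by split=> //; rewrite lam_k // ltnS leqNgt.
Qed.

Section Addition.
Variables (f : choice) (T : filling).
Hypothesis f_ok : choice_ok f.
Hypothesis T_tab : grid_tableau k (inner_len f) T.

Let choiceP i := choice_okP i f_ok.

Let mem_add i j (v : 'I_n) : (v \in add_max (f, T) (i, j))
  = (v \in T (i, j)) || (v == vk) && has_max f (i, j).
Proof.
rewrite ffunE /=; case: ifP => _; last by rewrite andbF orbF.
by rewrite in_setU1 andbT orbC.
Qed.

Let vk_notin i j : (vk \in T (i, j)) = false.
Proof.
case/grid_tableauP: T_tab => _ lt_k _ _.
by apply/negP => /lt_k; rewrite ltnn.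
Qed.

Lemma add_max_tableau : grid_tableau k.+1 lam (add_max (f, T)).
Proof.
case/grid_tableauP: (T_tab) => ne lt_k rows cols.
have mem_lt i j v : v \in T (i, j) -> (j < inner_len f i)%N.
  by move=> vT; rewrite -ne; apply/set0Pn; exists v.
apply/grid_tableauP; split=> [i j|i j v|i j j' v v' e|i i' j v v' e].
- have [le1 le2 _] := choiceP i.
  have -> : (add_max (f, T) (i, j) != set0) = (T (i, j) != set0) || has_max f (i, j).
    apply/set0Pn/orP => [[v]|].
      by rewrite mem_add => /orP[vT|/andP[_ ->]]; [left; apply/set0Pn; exists v | right].
    by case=> [/set0Pn[v vT]|mx]; [exists v | exists vk]; rewrite mem_add ?vT // mx eqxx orbT.
  rewrite ne /has_max /=; case: (ltnP j (inner_len f i)) => /= [lt|le].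
    by rewrite (leq_trans lt).
  by rewrite andbT.
- by rewrite mem_add => /orP[/lt_k/leqW//|/andP[/eqP->]].
- rewrite !mem_add => /orP[vT|/andP[/eqP-> mx]] /orP[v'T|/andP[/eqP-> _]] //.
  + exact: rows e vT v'T.
  + exact: ltnW (lt_k _ _ _ vT).
  + by case/andP: mx => _; have := mem_lt _ _ _ v'T; rewrite /= e; case: ltngtP => //=; lia.
- rewrite !mem_add => vT v'T.
  have [le1 le2 sh] := choiceP i; have [_ le3 _] := choiceP i'.
  have j_lam : (j < lam i')%N.
    case/orP: v'T => [/mem_lt lt|/andP[_ /andP[//]]].
    exact: leq_trans le3.
  case/orP: vT => [vT|/andP[_ /andP[_ /=]]].
    case/orP: v'T => [v'T|/andP[/eqP-> _]]; first exact: cols e vT v'T.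
    exact: lt_k vT.
  by rewrite e in j_lam; case/orP => [|/andP[/sh]]; lia.
Qed.

Lemma add_maxK : remove_max (add_max (f, T)) = (f, T).
Proof.
case/grid_tableauP: (T_tab) => ne lt_k rows cols.
have low i j : add_max (f, T) (i, j) :&: below n k = T (i, j).
  apply/setP => v; rewrite inE mem_add !inE.
  have [->|neq] /= := eqVneq v vk; first by rewrite ltnn andbF vk_notin.
  by rewrite orbF andb_idr // => /lt_k.
have lenE (i : 'I_n) : low_len (add_max (f, T)) i = inner_len f i.
  rewrite /low_len -[RHS](@card_ord_lt w); last first.
    by have [_ le _] := choiceP i; apply: leq_trans le (lam_leq_w _).
  by apply: eq_card => j; rewrite !inE low ne.
congr (_, _); last by apply/ffunP => -[i j]; rewrite ffunE low.
apply/ffunP => i; rewrite ffunE /= lenE /inner_len /= valK.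
have i_n : (i < n)%N := ltn_trans (ltn_ord i) k_n.
have [le1 le2 sh] := choiceP i; move: le1 le2 sh; rewrite /inner_len /shares_last valK.
case e: (f i) => [m c] /= le1 le2 sh; congr (_, _); first exact: inord_val.
apply/existsP/idP => [[j /andP[/eqP ej]]|c_true].
  rewrite mem_add vk_notin eqxx /= /has_max /inner_len /shares_last /= valK e /=.
  by rewrite -ej ltnn => /and3P[].
have m_gt0 := leq_ltn_trans (leq0n _) (sh c_true).
have j_w : (m.-1 < w)%N by rewrite prednK // -ltnS ltn_ord.
exists (Ordinal j_w); rewrite /= prednK // eqxx mem_add vk_notin eqxx /=.
rewrite /has_max /inner_len /shares_last /= valK e /= c_true prednK // eqxx orbT andbT.
by rewrite (leq_trans _ le2) ?prednK.
Qed.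
End Addition.

Lemma grid_tableau_sum (R : nmodType) (F : filling -> R) :
  \sum_(T | grid_tableau k.+1 lam T) F T
  = \sum_(f | choice_ok f) \sum_(T | grid_tableau k (inner_len f) T) F (add_max (f, T)).
Proof.
rewrite pair_big_dep /= (reindex_onto add_max remove_max) /=; last first.
  by move=> T; apply: remove_maxK.
apply: eq_big => [[f T]|[f T] _] //=.
apply/andP/andP => [[T_tab /eqP e]|[f_ok T_tab]].
  by have := remove_max_choice T_tab; have := remove_max_tableau T_tab; rewrite e.
by rewrite add_max_tableau // add_maxK.
Qed.
End Step.
End GridTableaux.

(** * Weighted sums over grid tableaux *)

Section GridWeight.
Variables (R : idomainType) (beta : R) (a : int -> R) (x : nat -> R) (n w : nat).
Hypothesis x_reg : forall i, (i < n)%N -> 1 + beta * x i != 0.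
Local Notation filling := {ffun 'I_n * 'I_w -> {set 'I_n}}.

Definition grid_entry (i j v : nat) : R :=
  oplus beta (x v) (a (v.+1%:Z + (j%:Z - i%:Z))).

(** The truncated predecessor gives empty cells weight 1 and lets the first value of a cell enter
    without a beta. *)
Definition cell_weight (p : 'I_n * 'I_w) (B : {set 'I_n}) : R :=
  beta ^+ #|B|.-1 * \prod_(v in B) grid_entry p.1 p.2 v.

Definition grid_sum (k : nat) (lam : nat -> nat) : R :=
  \sum_(T : filling | grid_tableau k lam T) \prod_p cell_weight p (T p).

Section Step.
Variables (k : nat) (lam : nat -> nat).
Hypothesis k_n : (k < n)%N.
Hypothesis lam_dec : forall i, (lam i.+1 <= lam i)%N.
Hypothesis lam_w : (lam 0%N <= w)%N.
Hypothesis lam_k : forall i, (k < i)%N -> lam i = 0%N.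
Local Notation vk := (Ordinal k_n).
Variable f : {ffun 'I_k -> 'I_w.+1 * bool}.
Hypothesis f_ok : choice_ok lam f.

Definition max_factor (i j : nat) : R :=
  if (j < lam i)%N then
    if (inner_len f i <= j)%N then grid_entry i j k
    else if shares_last f i && (j.+1 == inner_len f i) then beta * grid_entry i j k
    else 1
  else 1.

Lemma cell_weight_add T p : grid_tableau k (inner_len f) T ->
  cell_weight p (add_max lam k_n (f, T) p) = cell_weight p (T p) * max_factor p.1 p.2.
Proof.
case: p => i j /grid_tableauP[ne lt_k _ _].
have vkT : vk \notin T (i, j) by apply/negP => /lt_k; rewrite ltnn.
rewrite ffunE /has_max /max_factor /=; case: ltnP => _ /=; last by rewrite mulr1.
have -> : (inner_len f i <= j)%N = (T (i, j) == set0).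
  by rewrite leqNgt -ne negbK.
have [->|ne0] /= := eqVneq (T (i, j)) set0.
  by rewrite setU0 /cell_weight cards1 cards0 big_set1 big_set0 !mul1r.
case: ifP => _; last by rewrite mulr1.
rewrite /cell_weight cardsU1 vkT big_setU1 //=.
rewrite -[in LHS](prednK (n := #|T (i, j)|)) ?card_gt0 // exprS; ring.
Qed.

Let choiceP i := choice_okP lam_k i f_ok.

Lemma row_factor i :
  \prod_(j < w) max_factor i j
  = (\prod_(inner_len f i <= t < lam i) grid_entry i t k)
    * (if shares_last f i then beta * grid_entry i (inner_len f i).-1 k else 1).
Proof.
have [_ le sh] := choiceP i; have le_w := lam_leq_w lam_dec lam_w i.
rewrite -(big_mkord xpredT (max_factor i)) (big_cat_nat (n := lam i)) //=.
rewrite [X in _ * X]big_nat_cond [X in _ * X]big1 ?mulr1; last first.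
  by move=> j /andP[/andP[ge _] _]; rewrite /max_factor ltnNge ge.
rewrite (big_cat_nat (n := inner_len f i)) //= mulrC; congr (_ * _).
  rewrite big_nat_cond [RHS]big_nat_cond; apply: eq_bigr => j /andP[/andP[ge lt] _].
  by rewrite /max_factor lt ge.
move: le sh; rewrite /max_factor.
case: (inner_len f i) => [|m] le sh.
  by rewrite big_geq //; case: ifP => // /sh.
rewrite big_nat_recr //= le ltnn eqxx andbT big_nat_cond big1 ?mul1r // => j.
move=> /andP[/andP[_ lt] _]; rewrite (leq_trans lt (ltnW le)) leqNgt (leqW lt) /=.
by rewrite eqSS (ltn_eqF lt) andbF.
Qed.

(** Row k contains only the value k, with parameters a_1, .., a_(lam k); this gives the factorial
    power. *)
Lemma max_factor_prod :
  \prod_(p : 'I_n * 'I_w) max_factor p.1 p.2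
  = facpow beta a (x k) (lam k) * \prod_(i < k) row_weight beta a k lam x i (f i).
Proof.
rewrite -(pair_bigA _ (fun (i : 'I_n) (j : 'I_w) => max_factor i j)) /=.
under eq_bigr => i _ do rewrite row_factor.
pose F i := (\prod_(inner_len f i <= t < lam i) grid_entry i t k)
    * (if shares_last f i then beta * grid_entry i (inner_len f i).-1 k else 1).
rewrite -(big_mkord xpredT F) (big_cat_nat (n := k.+1)) //=.
rewrite [X in _ * X]big_nat_cond [X in _ * X]big1 ?mulr1; last first.
  move=> i /andP[/andP[k_i _] _]; rewrite /F lam_k // big_geq // mul1r.
  by rewrite /shares_last insubN // -leqNgt ltnW.
rewrite big_nat_recr //= mulrC; congr (_ * _).
  rewrite /F /shares_last /inner_len insubN ?ltnn // mulr1 big_mkord /facpow.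
  by apply: eq_bigr => t _; congr (oplus _ _ (a _)); lia.
rewrite big_mkord; apply: eq_bigr => i _; rewrite /F /row_weight.
have [_ _ sh] := choiceP i; move: sh; rewrite /inner_len /shares_last valK.
case: (f i) => [m c] /= sh; have i_k := ltn_ord i; congr (_ * _).
  by apply: eq_bigr => t _; congr (oplus _ _ (a _)); lia.
case: c sh => // /(_ isT) lt.
by congr (_ * oplus _ _ (a _)); lia.
Qed.
End Step.

Lemma grid_sum_step k lam : (k < n)%N -> (forall i, lam i.+1 <= lam i)%N ->
    (lam 0%N <= w)%N -> (forall i, (k < i)%N -> lam i = 0%N) ->
  grid_sum k.+1 lam
  = facpow beta a (x k) (lam k) *
    \sum_(f : {ffun 'I_k -> 'I_w.+1 * bool} | choice_ok lam f)
      (\prod_(i < k) row_weight beta a k lam x i (f i)) * grid_sum k (inner_len f).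
Proof.
move=> k_n lam_dec lam_w lam_k; rewrite /grid_sum (grid_tableau_sum k_n) //.
rewrite mulr_sumr; apply: eq_bigr => f f_ok; rewrite mulrA -max_factor_prod //.
rewrite mulr_sumr; apply: eq_bigr => T T_tab; rewrite mulrC -big_split /=.
by apply: eq_bigr => p _; rewrite cell_weight_add.
Qed.

(** Both sides satisfy the same recursion in k; the product of the x_j - x_k in [bialternant_branch]
    is the new part of the Vandermonde product. *)
Lemma grid_sum_bialternant k lam : (k <= n)%N -> (forall i, lam i.+1 <= lam i)%N ->
    (lam 0%N <= w)%N -> (forall i, (k <= i)%N -> lam i = 0%N) ->
  (\prod_(j < k) \prod_(i < j) (x i - x j)) * grid_sum k lam
  = bialternant beta a k lam x.
Proof.
elim: k lam => [|k IHk] lam k_n lam_dec lam_w lam_k.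
  rewrite big_ord0 mul1r /bialternant det_mx00 /grid_sum.
  rewrite (big_pred1 [ffun=> set0]) => [|T].
    by rewrite big1 // => p _; rewrite ffunE /cell_weight cards0 big_set0 mulr1.
  apply/grid_tableauP/eqP => [[ne _ _ _]|->].
    apply/ffunP => -[i j]; rewrite ffunE; apply/eqP.
    by rewrite -[_ == _]negbK ne lam_k.
  by split=> [i j|i j v|i j j' v v' _|i i' j v v' _]; rewrite !ffunE ?inE ?lam_k ?eqxx.
rewrite grid_sum_step //.
rewrite (@bialternant_branch R beta a k lam w.+1 x) ?x_reg //.
rewrite [X in _ = _ * _ * X](_ : _ = (\prod_(j < k) \prod_(i < j) (x i - x j)) *
    \sum_(f : {ffun 'I_k -> 'I_w.+1 * bool} | choice_ok lam f)
      (\prod_(i < k) row_weight beta a k lam x i (f i)) * grid_sum k (inner_len f)).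
  by rewrite big_ord_recr /=; ring.
rewrite mulr_sumr; apply: eq_bigr => f /forallP f_ok; rewrite mulrCA; congr (_ * _).
have len_le i : (inner_len f i <= lam i)%N.
  rewrite /inner_len; case: insubP => [i' _ <-|//].
  by have /and3P[] := f_ok i'.
rewrite IHk ?(ltnW k_n) // => [i||i k_i].
- have [i_k|k_i] := ltnP i k; last first.
    by rewrite {1}/inner_len insubN // -leqNgt leqW.
  apply: leq_trans (len_le _) _; rewrite /inner_len (insubT (fun i => i < k)%N i_k).
  by have /and3P[] := f_ok (Ordinal i_k).
- exact: leq_trans (len_le _) lam_w.
- by rewrite /inner_len insubN // -leqNgt.
Qed.
End GridWeight.

(** * Bialternant formula for straight shapes *)

Lemma big_entries (R : Type) (idx : R) (op : Monoid.com_law idx) n th (T : tableau n th)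
    (F : entry n th -> R) :
  \big[op/idx]_(e in entries T) F e
  = \big[op/idx]_al \big[op/idx]_(v in T al) F (v, al).
Proof.
rewrite (exchange_big_dep xpredT) //= pair_big_dep /=.
by apply: eq_big => [[v al]|[v al] _]; rewrite ?inE.
Qed.

Lemma Groth_cells (K : fieldType) (n : nat) (beta : K) (a : int -> K) theta :
  Groth n theta beta a =
  \sum_(T : tableau n theta | set_valued T) \prod_al
     ((beta%:MP : {mpoly K[n]}) ^+ #|T al|.-1
      * \prod_(v in T al) oplus beta%:MP 'X_v (a (v.+1%:Z + content al))%:MP).
Proof.
apply: eq_bigr => T /set_valued_neq0 ne.
rewrite big_split /= prodrXr -mul_mpolyC rmorphXn big_entries; congr (_ ^+ _ * _).
rewrite -sum1_card big_entries -sum1_card /= -sumnB => [|al _]; last by rewrite sum1_card card_gt0.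
by apply: eq_bigr => al _; rewrite sum1_card subn1.
Qed.

Section Straight.
Variable lam : part.
Local Notation lm := (nth 0%N lam).
Local Notation box := (box (straight lam)).

Lemma mem_cells_straight p : (p \in cells (straight lam)) = (p.2 < lm p.1)%N.
Proof.
apply/allpairsPdep/idP => [[i [j []]]|lt].
  by rewrite !mem_iota => _ /andP[_ lt] -> /=; move: lt; rewrite nth_nil subn0.
exists p.1, p.2; rewrite !mem_iota nth_nil subn0 -surjective_pairing lt /= !add0n.
by split=> //; rewrite ltnNge; apply: contraTN lt => ge; rewrite nth_default.
Qed.

Lemma col_lt (al : box) : (col al < lm (row al))%N.
Proof. by rewrite -(mem_cells_straight (val al)) ssvalP. Qed.


Section Grid.
Variables (n w : nat).
Hypothesis size_lam : (size lam <= n)%N.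
Hypothesis lam_w : (lm 0 <= w)%N.
Local Notation filling := {ffun 'I_n * 'I_w -> {set 'I_n}}.

Lemma row_ord (al : box) : (row al < n)%N.
Proof.
apply: leq_trans size_lam; rewrite ltnNge; apply/negP => ge.
by have := col_lt al; rewrite nth_default.
Qed.

Lemma col_ord (al : box) : (col al < w)%N.
Proof.
apply: leq_trans (col_lt al) (leq_trans _ lam_w).
by elim: (row al) => // i; apply: leq_trans; apply: part_dec.
Qed.

Definition grid_cell (al : box) : 'I_n * 'I_w := (Ordinal (row_ord al), Ordinal (col_ord al)).

Definition grid_box (p : 'I_n * 'I_w) : option box := insub (val p.1, val p.2).

Definition grid_filling (T : tableau n (straight lam)) : filling :=
  [ffun p => if grid_box p is Some al then T al else set0].

Definition grid_restrict (T : filling) : tableau n (straight lam) :=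
  [ffun al => T (grid_cell al)].

Lemma grid_cellK (al : box) : grid_box (grid_cell al) = Some al.
Proof. by rewrite /grid_box /= -surjective_pairing valK. Qed.

Lemma grid_filling_cell T al : grid_filling T (grid_cell al) = T al.
Proof. by rewrite ffunE grid_cellK. Qed.

Lemma grid_boxP (p : 'I_n * 'I_w) : (p.2 < lm p.1)%N -> {al | p = grid_cell al}.
Proof.
move=> lt; have mem : (val p.1, val p.2) \in cells (straight lam) by rewrite mem_cells_straight.
exists (SeqSub mem); case: p lt mem => i j lt mem.
by congr pair; apply: val_inj.
Qed.

Lemma grid_box_out (p : 'I_n * 'I_w) : (lm p.1 <= p.2)%N -> grid_box p = None.
Proof. by move=> ge; apply: insubN; rewrite mem_cells_straight -leqNgt. Qed.

Lemma grid_restrictK T : grid_tableau n lm T -> grid_filling (grid_restrict T) = T.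
Proof.
case/grid_tableauP => ne _ _ _; apply/ffunP => p.
have [/grid_boxP[al ->]|ge] := ltnP p.2 (lm p.1).
  by rewrite grid_filling_cell ffunE.
rewrite ffunE grid_box_out //; case: p ge => i j ge; apply/esym/eqP.
by rewrite -[_ == _]negbK ne -leqNgt.
Qed.

Lemma grid_fillingK T : grid_restrict (grid_filling T) = T.
Proof. by apply/ffunP => al; rewrite ffunE grid_filling_cell. Qed.

Lemma grid_filling_tableau T : grid_tableau n lm (grid_filling T) = set_valued T.
Proof.
have out p v : v \in grid_filling T p -> {al | p = grid_cell al}.
  have [/grid_boxP//|ge] := ltnP p.2 (lm p.1).
  by rewrite ffunE grid_box_out // inE.
apply/and4P/and3P => [[/forallP ne _ /forallP rows /forallP cols]
                     |[/forallP ne /forallP rows /forallP cols]].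
  split; apply/forallP => al.
  - by have := eqP (ne (grid_cell al)); rewrite grid_filling_cell col_lt => ->.
  - apply/forallP => al'; apply/implyP => e.
    have /forallP/(_ (grid_cell al')) := rows (grid_cell al).
    by rewrite !grid_filling_cell -val_eqE /= e.
  - apply/forallP => al'; apply/implyP => e.
    have /forallP/(_ (grid_cell al')) := cols (grid_cell al).
    by rewrite !grid_filling_cell -val_eqE /= e.
split; apply/forallP => p.
- have [/grid_boxP[al ->]|ge] := ltnP p.2 (lm p.1).
    by rewrite grid_filling_cell ne.
  by rewrite ffunE grid_box_out // eqxx.
- by apply/subsetP => v _; rewrite inE.
- apply/forallP => p'; apply/implyP => e.
  apply/'forall_implyP => v vT; apply/'forall_implyP => v' v'T.
  have [al ea] := out _ _ vT; have [al' ea'] := out _ _ v'T.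
  move: e vT v'T; rewrite {}ea {}ea' !grid_filling_cell -val_eqE /= => e vT v'T.
  have := implyP (forallP (rows al) al') e.
  by move=> /'forall_implyP/(_ v vT)/'forall_implyP/(_ v' v'T).
- apply/forallP => p'; apply/implyP => e.
  apply/'forall_implyP => v vT; apply/'forall_implyP => v' v'T.
  have [al ea] := out _ _ vT; have [al' ea'] := out _ _ v'T.
  move: e vT v'T; rewrite {}ea {}ea' !grid_filling_cell -val_eqE /= => e vT v'T.
  have := implyP (forallP (cols al) al') e.
  by move=> /'forall_implyP/(_ v vT)/'forall_implyP/(_ v' v'T).
Qed.

Lemma Groth_grid (K : fieldType) (beta : K) (a : int -> K) :
  Groth n (straight lam) beta a
  = grid_sum (beta%:MP : {mpoly K[n]}) (fun k => (a k)%:MP) (@mvar K n) n w n lm.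
Proof.
rewrite Groth_cells /grid_sum (reindex_onto grid_filling grid_restrict) /=; last first.
  exact: grid_restrictK.
apply: eq_big => [T|T _]; first by rewrite grid_filling_tableau grid_fillingK eqxx andbT.
rewrite [RHS](bigID (fun p : 'I_n * 'I_w => p.2 < lm p.1)%N) /= [X in _ * X]big1 ?mulr1; last first.
  move=> p; rewrite -leqNgt => ge.
  by rewrite ffunE grid_box_out // /cell_weight cards0 big_set0 mulr1.
rewrite (reindex_omap grid_cell grid_box) /=; last first.
  by move=> p /grid_boxP[al ->]; rewrite grid_cellK.
apply: eq_big => [al|al _]; first by rewrite grid_cellK eqxx col_lt.
rewrite grid_filling_cell /cell_weight; congr (_ * _); apply: eq_bigr => v _.
by rewrite /grid_entry mvarE.
Qed.
End Grid.

(** The theorem does not bound the length of [mu]. Values increase strictly down the first column,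
    so more than n rows leave no tableau. *)
Lemma Groth_size_gt (K : fieldType) n (beta : K) (a : int -> K) : (n < size lam)%N ->
  Groth n (straight lam) beta a = 0.
Proof.
move=> n_lam; rewrite /Groth big_pred0 // => T; apply/negbTE/negP.
move=> /and3P[/forallP ne _ /forallP cols].
have mem i : (i < size lam)%N -> (i, 0%N) \in cells (straight lam).
  by move=> lt; rewrite mem_cells_straight /=; have /is_partP[_] := valP lam; apply.
have low i (lt : (i < size lam)%N) (v : 'I_n) : v \in T (SeqSub (mem i lt)) -> (i <= v)%N.
  elim: i lt v => // i IHi lt v vT; have lt' := ltnW lt.
  have /set0Pn[u uT] := ne (SeqSub (mem i lt')).
  apply: leq_ltn_trans (IHi lt' u uT) _.
  have := implyP (forallP (cols (SeqSub (mem i lt'))) (SeqSub (mem i.+1 lt))).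
  by rewrite /col /row /= !eqxx => /(_ isT)/'forall_implyP/(_ u uT)/'forall_implyP/(_ v vT).
have /set0Pn[v /low] := ne (SeqSub (mem n n_lam)).
by rewrite leqNgt ltn_ord.
Qed.
End Straight.

Section Vandermonde.
Variables (K : fieldType) (n : nat) (beta : K) (a : int -> K).
Local Notation A := {mpoly K[n]}.

Lemma Groth_alternant (lam : part) : (size lam <= n)%N ->
  (\prod_(j < n) \prod_(i < j) (@mvar K n i - mvar K n j)) * Groth n (straight lam) beta a
  = alternant (diag_term n beta a lam).
Proof.
move=> size_lam; rewrite (Groth_grid size_lam (leqnn _)) grid_sum_bialternant //.
- by rewrite alternant_diag_term.
- move=> i i_n; rewrite (mvarE _ (Ordinal i_n)).
  apply: contra_neq (oner_neq0 K) => /(congr1 (meval (fun=> 0))).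
  by rewrite meval0 mevalD mevalM mevalXU mulr0 addr0 meval1.
- exact: part_dec.
- by move=> i n_i; rewrite nth_default // (leq_trans size_lam).
Qed.
End Vandermonde.

(** * Structure constants *)

Lemma is_part_chain (mu : part) n (R : seq 'I_n) : partition_chain mu R ->
  is_part (foldl incr_nth mu [seq val r | r <- R]).
Proof.
suff gen (s : seq nat) : is_part s -> partition_chain s R ->
  is_part (foldl incr_nth s [seq val r | r <- R]) by apply/gen/(valP mu).
by elim: R s => //= r R IHR s _ /andP[s_part /(IHR _ s_part)].
Qed.

Lemma size_foldl_incr n (s : seq nat) (R : seq 'I_n) :
  (size s <= size (foldl incr_nth s [seq val r | r <- R]))%N.
Proof.
elim: R s => //= r R IHR s; apply: leq_trans (IHR _).
by rewrite size_incr_nth; case: ltnP => // /leqW.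
Qed.

Lemma size_foldl_incr_le n (s : seq nat) (R : seq 'I_n) : (size s <= n)%N ->
  (size (foldl incr_nth s [seq val r | r <- R]) <= n)%N.
Proof.
elim: R s => //= r R IHR s s_n; apply: IHR.
by rewrite size_incr_nth; case: ifP.
Qed.

Section StructureConstants.
Variables (K : fieldType) (n : nat) (beta : K) (a b : int -> K).
Hypothesis beta_a : forall k, 1 + beta * a k != 0.
Hypothesis a_inj : injective a.
Local Notation D lam := (alternant (diag_term n beta a lam)).

Lemma alternant_coef (I : finType) (P : pred I) (c : I -> K) (e : I -> part)
    (g : {fsfun part -> K with 0}) (nu : part) :
    (size nu <= n)%N -> (forall i, P i -> (size (e i) <= n)%N) ->
    \sum_(i | P i) (c i)%:MP * D (e i)
    = \sum_(lam <- finsupp g | (size lam <= n)%N) (g lam)%:MP * D lam ->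
  g nu = \sum_(i | P i && (e i == nu)) c i.
Proof.
move=> size_nu size_e eqD.
(* A finite list that contains [nu] and every partition with at most n rows occurring on either
   side, so that independence applies to the difference [h]. *)
pose s := [seq lam : part <- undup (nu :: enum_fset (finsupp g) ++ [seq e i | i <- enum P])
          | (size lam <= n)%N].
have s_uniq : uniq s by rewrite filter_uniq ?undup_uniq.
have mem_s (lam : part) : (lam \in s) = (size lam <= n)%N && [|| lam == nu, lam \in finsupp g
    | lam \in [seq e i | i <- enum P]].
  by rewrite mem_filter mem_undup in_cons mem_cat.
pose h lam := g lam - \sum_(i | P i && (e i == lam)) c i.
suff /eqP : h nu = 0 by rewrite subr_eq0 => /eqP.
apply: (alternant_free (n := n) beta_a a_inj s_uniq (h := h)); last by rewrite mem_s size_nu eqxx.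
  by move=> lam; rewrite mem_s => /andP[].
rewrite (eq_bigr (fun lam : part => (g lam)%:MP * D lam
    - \sum_(i | P i && (e i == lam)) (c i)%:MP * D (e i))) => [|lam _]; last first.
  rewrite /h mpolyCB mulrBl rmorph_sum mulr_suml; congr (_ - _).
  by apply: eq_bigr => i /andP[_ /eqP->].
rewrite sumrB; apply/eqP; rewrite subr_eq0; apply/eqP.
rewrite (exchange_big_dep P) /= => [|lam i _ /andP[]//].
rewrite [RHS](eq_bigr (fun i => (c i)%:MP * D (e i))) => [|i Pi]; last first.
  rewrite (eq_bigl (pred1 (e i))) => [|lam]; last by rewrite Pi /= eq_sym.
  rewrite -big_filter filter_pred1_uniq ?big_seq1 // mem_s size_e //=.
  by rewrite map_f ?orbT // mem_enum.
rewrite eqD (bigID (fun lam => lam \in finsupp g)) /= [X in _ + X]big1 ?addr0; last first.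
  by move=> lam; rewrite memNfinsupp => /eqP->; rewrite mul0r.
rewrite -[LHS]big_filter -[RHS]big_filter; apply: perm_big; apply: uniq_perm.
- by rewrite filter_uniq.
- by rewrite filter_uniq ?fset_uniq.
- move=> lam; rewrite [RHS]mem_filter [LHS]mem_filter mem_s /=.
  by case: (lam \in finsupp g); rewrite ?andbF // orbT /= !andbT.
Qed.

Lemma Groth_structure_constants (theta : skew_shape) (mu nu : part)
    (g : {fsfun part -> K with 0}) :
    no_two_in_column theta -> (size nu <= n)%N ->
    Groth n theta beta b * Groth n (straight mu) beta a
    = \sum_(lam <- finsupp g | (size lam <= n)%N) g lam *: Groth n (straight lam) beta a ->
  g nu =
  \sum_(RT : {bseq (sumn nu) of 'I_n} * (tableau n theta * {set entry n theta})
         | is_chain mu nu RT.1 && related RT.1 RT.2)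
    beta ^+ (#|entries RT.2.1| - #|box theta|) * weight beta a b mu RT.1 RT.2.
Proof.
move=> theta_col size_nu g_def.
rewrite (sum_related mu nu (fun R TB => beta ^+ (#|entries TB.1| - #|box theta|)
  * weight beta a b mu R TB)).
(* [insubd] makes the final shape a partition for every pair; under [P] the default is never
   reached. *)
pose last_part (TB : tableau n theta * {set entry n theta}) : part :=
  insubd part0 (foldl incr_nth mu [seq val r | r <- barred_labels TB.2]).
pose P (TB : tableau n theta * {set entry n theta}) :=
  [&& set_valued TB.1, TB.2 \subset entries TB.1
    & partition_chain mu (barred_labels TB.2)].
have last_partE TB : P TB ->
    last_part TB = foldl incr_nth mu [seq val r | r <- barred_labels TB.2] :> seq nat.
  by case/and3P => _ _ chain; rewrite val_insubd is_part_chain.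
rewrite (@alternant_coef _ (fun TB => P TB && (size (last_part TB) <= n)%N)
  (fun TB => beta ^+ (#|entries TB.1| - #|box theta|)
     * weight beta a b mu (barred_labels TB.2) TB) last_part g nu) //.
- apply: eq_bigl => TB; rewrite /is_chain partition_chainE /rho take_size.
  have [PTB|] := boolP (P TB); last first.
    by rewrite /P => nP; apply/esym; apply: contraNF nP => /and4P[-> -> ->].
  rewrite -val_eqE /= last_partE //; case/and3P: PTB => -> -> -> /=.
  by rewrite andb_idl // => /eqP->.
- by move=> TB /andP[].
transitivity ((\prod_(j < n) \prod_(i < j) (@mvar K n i - mvar K n j))
  * (Groth n theta beta b * Groth n (straight mu) beta a)); last first.
  rewrite g_def mulr_sumr; apply: eq_bigr => lam size_lam.
  by rewrite -mul_mpolyC mulrCA Groth_alternant.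
(* If [mu] has more than n rows, its polynomial is 0, and since adding boxes never shortens a
   partition no chain ends in one with at most n rows. *)
have [size_mu|mu_size] := leqP (size mu) n; last first.
  rewrite Groth_size_gt // !mulr0 big_pred0 // => TB.
  apply/negbTE/negP => /andP[/last_partE->]; rewrite leqNgt.
  by rewrite (leq_trans mu_size) ?size_foldl_incr.
rewrite mulrCA Groth_alternant // Groth_mul_alternant //.
apply: eq_big => [TB|TB /andP[PTB _]]; last by rewrite last_partE.
by rewrite andb_idr // => /last_partE->; apply: size_foldl_incr_le.
Qed.
End StructureConstants.

(** * Nondegeneracy of the generic parameters *)

Lemma one_plus_mul_neq0 (R S : comNzRingType) (phi : {rmorphism R -> S}) p q :
  phi p = 0 -> 1 + p * q != 0.
Proof.
move=> p0; apply: contra_neq (oner_neq0 S) => /(congr1 phi).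
by rewrite rmorphD rmorphM rmorph1 rmorph0 p0 mul0r addr0.
Qed.

Section RationalFunctions.
Import monalg PolyIdomain.
Variable F : fieldType.
Lemma tofrac_inj : injective (@FracField.tofrac {malg F[{cmonom param}]}).
Proof. by move=> p q /eqP; rewrite tofrac_eq => /eqP. Qed.

Lemma mcoeff_var (u : {cmonom param}) (v : param) :
  mcoeff u (mkmalgU (ucm v) (1 : F)) = (ucm v == u)%:R.
Proof. exact: mcoeffU. Qed.

Lemma par_a_inj : injective (@par_a F).
Proof.
move=> i j e.
have e' : mkmalgU (ucm (ParA i)) (1 : F) = mkmalgU (ucm (ParA j)) (1 : F) 
  := tofrac_inj e.
have h : (ucm (ParA i) == ucm (ParA i))%:R = (ucm (ParA j) == ucm (ParA i))%:R :> F
  := etrans (esym (mcoeff_var _ _)) (etrans (congr1 (mcoeff _) e') (mcoeff_var _ _)).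
move: h; rewrite eqxx.
case: eqP => [em _|_ /eqP]; last by rewrite oner_eq0.
have := ucmE (ParA j) (ParA i); rewrite em ucmE eqxx => {e e' em}.
by case: eqP => // -[->].
Qed.

(** Taking constant coefficients is a ring morphism that sends the indeterminate beta to 0, hence 1
    + beta a_k to 1. *)
Lemma par_beta_a k : 1 + par_beta F * par_a F k != 0.
Proof.
rewrite /par_beta /par_a /param_ratfun -tofrac1 -tofracM -tofracD tofrac_eq0.
have root0 : mcoeff mone (mkmalgU (ucm Beta) (1 : F)) = 0.
  apply: etrans (mcoeff_var _ _) _.
  case: (ucm Beta =P mone) => // /eqP/cmP/(_ Beta).
  by rewrite ucmE cm1 eqxx.
exact: (@one_plus_mul_neq0 _ _ (mcoeff mone)) root0.
Qed.
End RationalFunctions.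

Theorem theorem6p1 (F : fieldType) (n : nat) (n_gt0 : (0 < n)%N)
    (theta : skew_shape) (theta_col : no_two_in_column theta)
    (mu nu : part) (size_nu : (size nu <= n)%N)
    (g : {fsfun part -> ratfun F with 0})
    (g_def :
       Groth n theta (par_beta F) (par_b F)
         * Groth n (straight mu) (par_beta F) (par_a F)
       = \sum_(lam <- finsupp g | (size lam <= n)%N)
           g lam *: Groth n (straight lam) (par_beta F) (par_a F)) :
  g nu =
  \sum_(RT : {bseq (sumn nu) of 'I_n}
               * (tableau n theta * {set entry n theta})
         | is_chain mu nu RT.1 && related RT.1 RT.2)
    par_beta F ^+ (#|entries RT.2.1| - #|box theta|)
    * weight (par_beta F) (par_a F) (par_b F) mu RT.1 RT.2.
Proof.
exact: (@Groth_structure_constants _ n _ _ (@par_b F) (@par_beta_a F) (@par_a_inj F)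
  theta mu nu g theta_col size_nu g_def).
Qed.
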